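(* Let $\mathbb{H}$ be a separable real Hilbert space and let $X$ be a random element of $\mathbb{H}$ that is regularly varying with some index $\alpha>0$ and limit angular measure $P_{\Theta,\infty}$ on the unit sphere of $\mathbb{H}$. Let $R=\|X\|$, $\Theta=X/\|X\|$, $C_t=\mathbb{E}[\Theta\otimes\Theta\mid R>t]$ for $t>0$, and $C_\infty=\mathbb{E}[\Theta_\infty\otimes\Theta_\infty]$ with $\Theta_\infty\sim P_{\Theta,\infty}$. Let $\lambda_\infty^1\ge\lambda_\infty^2\ge\dots\ge0$ be the ordered eigenvalues of $C_\infty$ (with multiplicity), and let $p\ge1$ be an integer such that $\lambda_\infty^p>\lambda_\infty^{p+1}$. Let $V_t^p$ and $V_\infty^p$ be the linear spans of the first $p$ eigenfunctions of $C_t$ and $C_\infty$ respectively. Then, as $t\to\infty$, $$\rho(V_t^p,V_\infty^p)\to0.$$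
   Context: For $f,g\in\mathbb{H}$, $f\otimes g$ is the operator $h\mapsto\langle f,h\rangle g$. $HS(\mathbb{H})$ is the Hilbert space of Hilbert–Schmidt operators on $\mathbb{H}$ with norm $\|T\|_{HS(\mathbb{H})}=(\sum_i\|Te_i\|^2)^{1/2}$ for any orthonormal basis $(e_i)$; expectations of operators are Bochner integrals in $HS(\mathbb{H})$. For finite-dimensional subspaces $V,W$ of $\mathbb{H}$, $\rho(V,W)=\|\Pi_V-\Pi_W\|_{HS(\mathbb{H})}$, where $\Pi_V$ is the orthogonal projection onto $V$. The ''first $p$ eigenfunctions'' of a compact nonnegative self-adjoint operator are the first $p$ elements of an orthonormal system of eigenvectors sorted by nonincreasing eigenvalue (counted with multiplicity). Regular variation. Let $\mathbb{H}_0=\mathbb{H}\setminus\{0\}$. Let $\mathcal{C}_0$ be the set of bounded continuous functions $f:\mathbb{H}_0\to\mathbb{R}$ vanishing in some neighborhood of $0$, and $M_0$ the class of Borel measures on $\mathbb{H}_0$ that are finite on every Borel subset bounded away from $0$. $\mu_n\to\mu$ in $M_0$ if $\int f\,d\mu_n\to\int f\,d\mu$ for all $f\in\mathcal{C}_0$. A measurable function $b$ is regularly varying with index $\rho$ if $b(tx)/b(t)\to x^\rho$ as $t\to\infty$ for every $x>0$. $X$ is regularly varying with index $\alpha>0$ if there exist a nonzero $\mu\in M_0$ and a regularly varying function $b$ such that $b(n)\mathbb{P}(X\in n\,\cdot)\to\mu$ in $M_0$ as $n\to\infty$, where $\mu(tA)=t^{-\alpha}\mu(A)$ for all $t>0$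 and Borel $A\subset\mathbb{H}_0$. Known equivalent characterization (polar form): $X$ is regularly varying with index $\alpha$ if and only if $\|X\|$ is regularly varying in $\mathbb{R}$ with index $\alpha$ and there is a probability measure $P_{\Theta,\infty}$ on the unit sphere such that $P_{\Theta,t}:=\mathbb{P}(\Theta\in\cdot\mid R>t)\to P_{\Theta,\infty}$ weakly as $t\to\infty$; this $P_{\Theta,\infty}$ is the limit angular measure. *)

(* Defs.v *)
From HB Require Import structures.
From mathcomp Require Import all_boot all_order all_algebra.
From mathcomp Require Import all_classical all_reals all_analysis.

Set Implicit Arguments.
Unset Strict Implicit.
Unset Printing Implicit Defensive.

Import Order.TTheory GRing.Theory Num.Theory.
Import numFieldNormedType.Exports.

Local Open Scope classical_set_scope.
Local Open Scope ring_scope.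

HB.mixin Record isHilbert (R : realType) H of CompleteNormedModule R H := {
  inner : H -> H -> R;
  innerC : forall x y, inner x y = inner y x;
  innerPl : forall a x y z, inner (a *: x + y) z = a * inner x z + inner y z;
  inner_norm : forall x, inner x x = `|x| ^+ 2
}.

#[short(type="hilbertType")]
HB.structure Definition Hilbert (R : realType) :=
  {H of CompleteNormedModule R H & isHilbert R H}.

Notation borel H := (g_sigma_algebraType (@open H)).

Definition separable (T : topologicalType) : Prop :=
  exists2 D : set T, countable D & dense D.

Section HilbertSchmidt.
Context {R : realType} {H : hilbertType R}.
Implicit Types (E V W : set H) (S T C : H -> H).

Definition orthonormal E : Prop :=
  forall e f, E e -> E f -> inner e f = (e == f)%:R.

(* Maximality is the usual form of totality, valid in any dimension. *)
Definition orthonormal_basis E : Prop :=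
  orthonormal E /\ forall x, (forall e, E e -> inner e x = 0) -> x = 0.

Lemma orthonormal_basis_exists : exists E, orthonormal_basis E.
Proof.
have [|E [oE maxE]] := @Zorn_bigcup H orthonormal.
  move=> F FP Ftot e f [A FA Ae] [B FB Bf].
  have [AB|BA] := Ftot _ _ FA FB; first exact: (FP _ FB) (AB _ Ae) Bf.
  exact: (FP _ FA) Ae (BA _ Bf).
exists E; split=> // x xE; apply/eqP/negP => /negP x0.
have nx0 : `|x| != 0 by rewrite normr_eq0.
have innerZl (a : R) (y z : H) : inner (a *: y) z = a * inner y z.
  have i0 : inner (0 : H) z = 0.
    by have := innerPl 1 0 0 z; rewrite scaler0 addr0 mul1r
      -[LHS]addr0 => /addrI /esym.
  by have := innerPl a y 0 z; rewrite addr0 i0 addr0.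
pose u : H := `|x|^-1 *: x.
have uE (e : H) : E e -> inner u e = 0 by move=> Ee; rewrite innerZl innerC xE ?mulr0.
have uu : inner u u = 1 by rewrite innerZl innerC innerZl inner_norm
  expr2 mulKf ?mulVf.
have Eu : ~ E u.
  by move=> /uE; rewrite uu => /eqP; rewrite oner_eq0.
apply: (maxE (E `|` [set u])).
  split; last by move=> /(_ u (or_intror erefl)).
  by move=> e Ee; left.
move=> e f [Ee|->] [Ef|->]; first exact: oE.
- by rewrite innerC uE //; case: eqP => // eu; case: Eu; rewrite -eu.
- by rewrite uE //; case: eqP => // eu; case: Eu; rewrite eu.
- by rewrite uu eqxx.
Qed.

(* A chosen orthonormal basis; for continuous linear [T] the value of
   [hs_norm T] does not depend on the choice. *)
Definition onb : set H := get orthonormal_basis.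

Definition hs_norm T : \bar R :=
  sqrte (\esum_(e in onb) (`|T e| ^+ 2)%:E).

Definition hs_dist S T : \bar R := hs_norm (S - T).

Definition hs_operator T : Prop :=
  [/\ linear T, continuous T & (hs_norm T < +oo)%E].

Definition tensor (f g : H) : H -> H := fun h => inner f h *: g.

Definition orth_proj V (h : H) : H :=
  get [set v | V v /\ forall u, V u -> inner u (h - v) = 0].

Definition rho V W : \bar R := hs_dist (orth_proj V) (orth_proj W).

Definition span_first (p : nat) (phi : nat -> H) : set H :=
  [set h | exists c : nat -> R, h = \sum_(i < p) c i *: phi i].

(* [eigensystem C lam phi]: [phi 0, phi 1, ...] is an orthonormal system of
   eigenvectors of [C] with eigenvalues [lam 0 >= lam 1 >= ... >= 0] repeated
   according to multiplicity, and [C] vanishes on its orthogonal complement (so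
   every positive eigenvalue is listed).  If [dim H] is finite the list of
   eigenvectors is exhausted after [dim H] terms: then, and only then, it is
   padded with [phi i = 0] and [lam i = 0]. *)
Definition eigensystem C (lam : nat -> R) (phi : nat -> H) : Prop :=
  [/\ forall i j, i != j -> inner (phi i) (phi j) = 0,
      forall i, `|phi i| = 1 \/
        [/\ phi i = 0, lam i = 0 &
            forall h, (forall j, (j < i)%N -> inner (phi j) h = 0) -> h = 0],
      forall i, C (phi i) = lam i *: phi i,
      (forall i, 0 <= lam i) /\ (forall i j, (i <= j)%N -> lam j <= lam i) &
      forall h, (forall i, inner (phi i) h = 0) -> C h = 0].

End HilbertSchmidt.

Section Bochner.
Context {R : realType} {H : hilbertType R} {d : measure_display}
  {T : measurableType d}.
Variable mu : set T -> \bar R.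
Implicit Types (F s : T -> H -> H) (C : H -> H).

Definition hs_simple s : Prop :=
  [/\ finite_set (range s), forall S, measurable (s @^-1` [set S]) &
      forall w, hs_operator (s w)].

Definition simple_integral s : H -> H :=
  \sum_(S \in range s) fine (mu (s @^-1` [set S])) *: S.

(* [C] is the Bochner integral of [F] in the space of Hilbert-Schmidt
   operators, for a finite measure [mu]. *)
Definition is_bochner_integral F C : Prop :=
  [/\ forall w, hs_operator (F w), hs_operator C &
  exists s : nat -> T -> H -> H,
  [/\ forall n, hs_simple (s n),
      {ae mu, forall w, hs_dist (F w) (s n w) @[n --> \oo] --> 0%E},
      (\int[mu]_w hs_dist (F w) (s n w))%E @[n --> \oo] --> 0%E &
      hs_dist (simple_integral (s n)) C @[n --> \oo] --> 0%E]].

Definition bochner_integral F : H -> H := get (is_bochner_integral F).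

End Bochner.

Definition regularly_varying (R : realType) (b : R -> R) (index : R) : Prop :=
  measurable_fun (`]0, +oo[ : set R) b /\
  forall x, 0 < x -> b (t * x) / b t @[t --> +oo] --> x `^ index.

(* Borel measures on [H_0 = H \ {0}] are represented by measures on the Borel
   sets of [H] of which only the values on subsets of [H0] are used;
   likewise measures on the unit sphere and functions on either set. *)
Section RegularVariation.
Context {R : realType} {H : hilbertType R}.

Definition H0 : set H := [set x | x != 0].

Definition dilate (t : R) (A : set H) : set H := [set t *: x | x in A].

Definition bounded_away0 (A : set H) : Prop :=
  exists2 r : R, 0 < r & forall x, A x -> r <= `|x|.

Definition C0 (f : H -> R) : Prop :=
  [/\ {within H0, continuous f},
      exists M : R, forall x, x != 0 -> `|f x| <= M &
      exists2 r : R, 0 < r & forall x, x != 0 -> `|x| < r -> f x = 0].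

Definition M0 (mu : set (borel H) -> \bar R) : Prop :=
  forall A : set (borel H), measurable A -> bounded_away0 A ->
    (mu A < +oo)%E.

Definition M0_cvg (mun : nat -> set (borel H) -> \bar R)
    (mu : set (borel H) -> \bar R) : Prop :=
  forall f, C0 f ->
    (\int[mun n]_(x in H0) (f x)%:E)%E @[n --> \oo] -->
    (\int[mu]_(x in H0) (f x)%:E)%E.

Context {d : measure_display} {T : measurableType d}.
Variables (P : probability T R) (X : T -> borel H).

(* [0 <= b n] says that [b(n) P(X \in n .)] is a (nonnegative) measure. *)
Definition regularly_varying_element (alpha : R) : Prop :=
  exists (mu : {measure set (borel H) -> \bar R}) (b : R -> R) (index : R),
  [/\ M0 mu /\ mu H0 != 0%E,
      regularly_varying b index /\ (forall n, (0 < n)%N -> 0 <= b n%:R),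
      M0_cvg (fun n A => ((b n%:R)%:E * P (X @^-1` dilate n%:R A))%E) mu &
      forall (t : R) (A : set (borel H)), 0 < t -> measurable A ->
        A `<=` H0 -> mu (dilate t A) = ((t `^ (- alpha))%:E * mu A)%E].

Definition exceed (t : R) : set T := [set w | t < `|X w : H|].

Definition cond_prob (E : set T) : set T -> \bar R :=
  fun A => (P (A `&` E) / P E)%E.

Definition angle (w : T) : borel H := `|X w : H|^-1 *: (X w : H).

Definition unit_sphere : set (borel H) := [set x : H | `|x| = 1].

Definition limit_angular_measure (Q : probability (borel H) R) : Prop :=
  Q unit_sphere = 1%E /\
  forall f : H -> R, {within unit_sphere : set H, continuous f} ->
    (exists M : R, forall x, unit_sphere x -> `|f x| <= M) ->
    (\int[pushforward (cond_prob (exceed t)) angle]_(x in unit_sphere)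
       (f x)%:E)%E @[t --> +oo] -->
    (\int[Q]_(x in unit_sphere) (f x)%:E)%E.

Definition cov_exceed (t : R) : H -> H :=
  bochner_integral (cond_prob (exceed t)) (fun w => tensor (angle w) (angle w)).

End RegularVariation.

(* Main.v *)
Require Import Defs.
From HB Require Import structures.
From mathcomp Require Import all_boot all_order all_algebra.
From mathcomp Require Import all_classical all_reals all_analysis.
From mathcomp Require Import measurable_realfun.
From mathcomp Require Import ring lra.

Set Implicit Arguments.
Unset Strict Implicit.
Unset Printing Implicit Defensive.

Import Order.TTheory GRing.Theory Num.Theory.
Import numFieldNormedType.Exports.

Local Open Scope classical_set_scope.
Local Open Scope ring_scope.

(* The second-moment forms B_t(x, y) = E[<Theta, x><Theta, y> | R > t] converge
   to B(x, y) = E[<Theta_oo, x><Theta_oo, y>] pointwise, as the integrands are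
   continuous and bounded on the sphere.  Since |Theta| = 1, the mass of B_t
   outside the span of e_0, ..., e_{n-1} is at most 1 - sum_{i<n} B_t(e_i, e_i),
   which converges to the same expression for B and is small for large n; so the
   quadratic forms converge uniformly on the unit ball.  Ky Fan's principle,
   applied to C_t and to C_oo, then bounds p - sum_{j,k<p} <phi^t_j, phi^oo_k>^2
   by 2 p sup|B_t - B| / (lambda^p - lambda^{p+1}), and this quantity controls
   rho.  Bochner integrability of Theta (x) Theta comes from replacing Theta by a
   nearest point among finitely many points of a dense sequence. *)

(** The unit ball is not compact, so pointwise convergence of forms could miss mass escaping to high
    coordinates; what prevents this is that the limit form has trace exactly 1. The covariance
    operators enter only through the identity <x, C y> = B(x, y). Since the Bochner integral is an
    arbitrary choice among candidates, this needs both existence of a Bochner integral and the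
    identity for every candidate.

    Individual eigenvectors need not converge: signs and multiple eigenvalues leave them
    undetermined. The quantity p - sum <phi^t_j, phi^oo_k>^2 avoids this, being the total squared
    distance of the phi^t_j from the limit eigenspace. A spectral gap is known for C_oo only, and Ky
    Fan's inequality at C_t contributes nothing but a sign.

    An eigensystem may be padded with zeros, so sequences with zero entries are carried throughout,
    and it has to be shown that no padding occurs among the first p vectors. *)

Section InnerProduct.
Context {R : realType} {H : hilbertType R}.
Implicit Types (x y z : H) (a b : R).

Lemma innerDl x y z : inner (x + y) z = inner x z + inner y z.
Proof. by have := innerPl 1 x y z; rewrite scale1r mul1r. Qed.

Lemma inner0l x : inner (0 : H) x = 0.
Proof. by apply: (addrI (inner (0 : H) x)); rewrite -innerDl !addr0. Qed.

Lemma innerZl a x y : inner (a *: x) y = a * inner x y.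
Proof. by have := innerPl a x 0 y; rewrite !addr0 inner0l addr0. Qed.

Lemma innerNl x y : inner (- x) y = - inner x y.
Proof. by rewrite -scaleN1r innerZl mulN1r. Qed.

Lemma innerBl x y z : inner (x - y) z = inner x z - inner y z.
Proof. by rewrite innerDl innerNl. Qed.

Lemma innerDr x y z : inner x (y + z) = inner x y + inner x z.
Proof. by rewrite innerC innerDl !(innerC x). Qed.

Lemma inner0r x : inner x (0 : H) = 0.
Proof. by rewrite innerC inner0l. Qed.

Lemma innerZr a x y : inner x (a *: y) = a * inner x y.
Proof. by rewrite innerC innerZl (innerC x). Qed.

Lemma innerNr x y : inner x (- y) = - inner x y.
Proof. by rewrite innerC innerNl (innerC x). Qed.

Lemma innerBr x y z : inner x (y - z) = inner x y - inner x z.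
Proof. by rewrite innerDr innerNr. Qed.

Lemma inner_suml I (r : seq I) (Q : pred I) (f : I -> H) y :
  inner (\sum_(i <- r | Q i) f i) y = \sum_(i <- r | Q i) inner (f i) y.
Proof. by apply: (big_morph (inner^~ y)) => [u v|]; rewrite ?innerDl ?inner0l. Qed.

Lemma inner_sumr I (r : seq I) (Q : pred I) (f : I -> H) y :
  inner y (\sum_(i <- r | Q i) f i) = \sum_(i <- r | Q i) inner y (f i).
Proof. by rewrite innerC inner_suml; apply: eq_bigr => i _; rewrite innerC. Qed.

Lemma normD2 x y : `|x + y| ^+ 2 = `|x| ^+ 2 + 2 * inner x y + `|y| ^+ 2.
Proof. by rewrite -!inner_norm innerDl !innerDr (innerC y x); ring. Qed.

Lemma normB2 x y : `|x - y| ^+ 2 = `|x| ^+ 2 - 2 * inner x y + `|y| ^+ 2.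
Proof. by rewrite normD2 innerNr normrN; ring. Qed.

(** The squared norm of |y|^2 x - <x, y> y is |y|^2 times the difference of the squared sides. *)
Lemma CauchySchwarz_inner x y : `|inner x y| <= `|x| * `|y|.
Proof.
have [->|y0] := eqVneq y 0; first by rewrite inner0r !normr0 mulr0.
have y2 : 0 < `|y| ^+ 2 by rewrite exprn_gt0 // normr_gt0.
rewrite -ler_sqr ?nnegrE ?mulr_ge0 // real_normK ?num_real // exprMn.
rewrite -subr_ge0 -(pmulr_rge0 _ y2).
have := sqr_ge0 `|(`|y| ^+ 2) *: x - inner x y *: y|.
rewrite normB2 innerZl innerZr !normrZ !exprMn !real_normK ?num_real //.
move=> /le_trans; apply; rewrite le_eqVlt; apply/orP; left; apply/eqP; ring.
Qed.

Lemma inner_eq0 x : inner x x = 0 -> x = 0.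
Proof. by rewrite inner_norm => /eqP; rewrite sqrf_eq0 normr_eq0 => /eqP. Qed.

Lemma bounded_linear_continuous (V : normedModType R) (f : H -> V) (M : R) :
  (forall x y, f (x - y) = f x - f y) -> (forall x, `|f x| <= M * `|x|) ->
  continuous f.
Proof.
move=> fB fM x; apply/cvgrPdist_lt => e e0.
(* [M] may be zero or negative, hence this positive majorant as divisor. *)
have M0 : 0 < `|M| + 1 by rewrite ltr_wpDl.
near=> y; rewrite -fB (le_lt_trans (fM _)) //.
have : `|x - y| < e / (`|M| + 1).
  by near: y; apply: cvgr_dist_lt => //; rewrite divr_gt0.
rewrite ltr_pdivlMr // => /(le_lt_trans _); apply.
rewrite mulrC ler_wpM2l // (le_trans (ler_norm _)) // lerDl //.
Unshelve. all: by end_near. Qed.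

Lemma inner_continuousl y : continuous (fun x => inner x y : R).
Proof.
apply: (@bounded_linear_continuous R^o _ `|y|) => [u v|x]; first exact: innerBl.
by rewrite mulrC CauchySchwarz_inner.
Qed.

Lemma inner_continuous y : continuous (fun x => inner y x : R).
Proof.
apply: (@bounded_linear_continuous R^o _ `|y|) => [u v|x]; first exact: innerBr.
exact: CauchySchwarz_inner.
Qed.

End InnerProduct.

(** Lagrange's identity: the double sum of squared 2 x 2 minors is twice the difference of the two
    sides. *)
Lemma CauchySchwarz_sum (R : realType) (I : finType) (a b : I -> R) :
  (\sum_i a i * b i) ^+ 2 <= (\sum_i a i ^+ 2) * (\sum_i b i ^+ 2).
Proof.
have : 0 <= \sum_i \sum_j (a i * b j - a j * b i) ^+ 2.
  by apply: sumr_ge0 => i _; apply: sumr_ge0 => j _; exact: sqr_ge0.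
have -> : \sum_i \sum_j (a i * b j - a j * b i) ^+ 2 =
    \sum_i \sum_j (a i ^+ 2 * b j ^+ 2) + \sum_i \sum_j (b i ^+ 2 * a j ^+ 2)
    - \sum_i \sum_j 2 * (a i * b i * (a j * b j)).
  rewrite -big_split -sumrB; apply: eq_bigr => i _ /=.
  by rewrite -big_split -sumrB; apply: eq_bigr => j _ /=; ring.
have -> : \sum_i \sum_j 2 * (a i * b i * (a j * b j)) =
    2 * \sum_i \sum_j a i * b i * (a j * b j).
  by rewrite mulr_sumr; apply: eq_bigr => i _; rewrite mulr_sumr.
rewrite -!big_distrlr /= expr2; nra.
Qed.

(** * Orthogonal sequences, Bessel's inequality, Riesz-Fischer *)

Section OrthogonalSequence.
Context {R : realType} {H : hilbertType R}.
Implicit Types (x y : H) (f : nat -> H).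

(* Zero entries are allowed, so that finite systems are padded sequences. *)
Definition orthoseq f :=
  (forall i j, i != j -> inner (f i) (f j) = 0) /\
  (forall i, `|f i| = 1 \/ f i = 0).

Definition partial_proj f n x := \sum_(i < n) inner (f i) x *: f i.

(** Handles unit and zero entries together: the factor [|f i| ^+ 2] left by an inner product is
    absorbed in both cases. *)
Lemma orthoseq_scale f : orthoseq f -> forall i, `|f i| ^+ 2 *: f i = f i.
Proof.
by case=> _ f1 i; case: (f1 i) => ->; rewrite ?expr1n ?scale1r ?scaler0.
Qed.

Lemma orthoseq_norm_le1 f : orthoseq f -> forall i, `|f i| <= 1.
Proof. by case=> _ f1 i; case: (f1 i) => ->; rewrite ?normr0. Qed.

Lemma inner_partial_proj f n x y :
  inner y (partial_proj f n x) = \sum_(i < n) inner (f i) x * inner (f i) y.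
Proof.
by rewrite inner_sumr; apply: eq_bigr => i _; rewrite innerZr (innerC y).
Qed.

Lemma inner_orthoseq_lincomb f n (c : nat -> R) j : orthoseq f ->
  inner (f j) (\sum_(i < n) c i *: f i) =
  if (j < n)%N then c j * `|f j| ^+ 2 else 0.
Proof.
move=> [oF _]; rewrite inner_sumr; case: ifPn => [jn|/negP jn].
  rewrite (bigD1 (Ordinal jn)) //= innerZr inner_norm big1 ?addr0 // => i ij.
  by rewrite innerZr oF ?mulr0 // eq_sym.
apply: big1 => i _; rewrite innerZr oF ?mulr0 //.
by apply/eqP => ji; apply: jn; rewrite ji ltn_ord.
Qed.

Lemma inner_orthoseq_partial_proj f n x j : orthoseq f ->
  inner (f j) (partial_proj f n x) = if (j < n)%N then inner (f j) x else 0.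
Proof.
move=> oF; rewrite (inner_orthoseq_lincomb _ (fun i => inner (f i) x)) //.
by case: ifP => // _; rewrite mulrC -innerZl orthoseq_scale.
Qed.

Lemma norm_partial_proj f n x : orthoseq f ->
  `|partial_proj f n x| ^+ 2 = \sum_(i < n) inner (f i) x ^+ 2.
Proof.
move=> oF; rewrite -inner_norm inner_partial_proj.
apply: eq_bigr => i _; rewrite inner_orthoseq_partial_proj // ltn_ord.
by rewrite expr2.
Qed.

Lemma partial_proj_residual f n x : orthoseq f ->
  `|x - partial_proj f n x| ^+ 2 = `|x| ^+ 2 - \sum_(i < n) inner (f i) x ^+ 2.
Proof.
move=> oF; rewrite normB2 norm_partial_proj // inner_partial_proj.
under eq_bigr do rewrite -expr2.
by ring.
Qed.

Lemma bessel f n x : orthoseq f -> \sum_(i < n) inner (f i) x ^+ 2 <= `|x| ^+ 2.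
Proof. by move=> oF; rewrite -subr_ge0 -partial_proj_residual // sqr_ge0. Qed.

Lemma norm_partial_proj_le f n x : orthoseq f -> `|partial_proj f n x| <= `|x|.
Proof.
move=> oF; rewrite -ler_sqr ?nnegrE //; rewrite norm_partial_proj //.
exact: bessel.
Qed.

(* Riesz-Fischer, using completeness of [H]. *)
Lemma partial_proj_cvg f x : orthoseq f ->
  exists2 l : H, partial_proj f n x @[n --> \oo] --> l &
    forall i, inner (f i) (x - l) = 0.
Proof.
move=> oF.
pose u n := \sum_(i < n) inner (f i) x ^+ 2.
have u_nd : nondecreasing_seq u.
  apply/nondecreasing_seqP => n; rewrite /u big_ord_recr /= lerDl sqr_ge0 //.
have u_cvg : cvgn u.
  apply: nondecreasing_is_cvgn => //.
  by exists (`|x| ^+ 2) => _ [n _ <-]; exact: bessel.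
have duE m n : (m <= n)%N ->
    `|partial_proj f n x - partial_proj f m x| ^+ 2 = u n - u m.
  move=> mn; rewrite normB2 !norm_partial_proj // inner_partial_proj -/(u n) -/(u m).
  under eq_bigr => i _ do rewrite inner_orthoseq_partial_proj //
    (leq_trans (ltn_ord i) mn) -expr2.
  by rewrite -/(u m); ring.
have p_cauchy : cauchy (partial_proj f n x @[n --> \oo]).
  apply/cauchy_ballP => e e0.
  (* By [duE] differences of [u] are squared distances, so radius [e] for the projections
     corresponds to radius [e ^+ 2] for [u]. *)
  have /cvg_cauchy/cauchy_ballP/(_ (e ^+ 2)) := u_cvg.
  move=> /(_ (exprn_gt0 _ e0)) [[A B]] /= [[N _ NA] [M _ MB]] AB.
  exists (partial_proj f ^~ x @` [set n | (maxn N M <= n)%N],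
          partial_proj f ^~ x @` [set n | (maxn N M <= n)%N]).
    by split; exists (maxn N M) => // n /= Nn; exists n.
  move=> [_ _] /= [[m /= Nm <-] [n /= Nn <-]].
  wlog mn : m n Nm Nn / (m <= n)%N => [W|].
    have [/W|/ltnW/W] := leqP m n; first exact.
    by move=> /(_ Nn Nm) /ball_sym.
  have : ball (u m) (e ^+ 2) (u n).
    by apply: (AB (u m, u n)); split; [apply: NA|apply: MB] => /=;
      rewrite (leq_trans _ Nm, leq_trans _ Nn) // (leq_maxl, leq_maxr).
  rewrite -!ball_normE /= distrC ger0_norm ?subr_ge0 ?u_nd // -duE //.
  by rewrite distrC ltr_sqr ?nnegrE ?(ltW e0).
have /cauchy_cvgP /cvg_ex [l pl] := p_cauchy.
exists l => // i.
rewrite innerBr; apply/eqP; rewrite subr_eq0; apply/eqP.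
have h1 : inner (f i) (partial_proj f n x) @[n --> \oo] --> inner (f i) l.
  by apply: (cvg_comp _ _ pl); exact: inner_continuous.
have h2 : inner (f i) (partial_proj f n x) @[n --> \oo] --> inner (f i) x.
  apply: cvg_near_cst; exists i.+1 => // n /= ni.
  by rewrite inner_orthoseq_partial_proj // ni.
exact: (cvg_unique _ h2 h1).
Qed.

End OrthogonalSequence.

(** * Enumerating the chosen basis; Hilbert-Schmidt norms as series *)

Section Basis.
Context {R : realType} {H : hilbertType R}.
Implicit Types (x y : H) (e : nat -> H) (S T : H -> H).

(** Enumerates the very set [onb] that defines [hs_norm], so that the norm becomes a series over
    [nat] without changing the basis. Zeros pad the list when [onb] is finite or the enumeration has
    holes. *)
Definition basis_seq e :=
  [/\ orthoseq e, forall b, onb b -> exists i, e i = b &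
      forall i, onb (e i) \/ e i = 0].

Lemma onbP : orthonormal_basis (onb : set H).
Proof. exact: (@getPex _ orthonormal_basis orthonormal_basis_exists). Qed.

(** Distinct basis vectors are at distance sqrt 2, so balls of radius 1/2 around them are disjoint,
    and a point of the dense set in each one encodes its centre. *)
Lemma countable_onb : separable H -> countable (onb : set H).
Proof.
move=> [D Dc Dd]; have [oB _] := onbP.
have near_pt (b : H) : {x | D x /\ `|b - x| < 2^-1}.
  apply: cid; have [|x] := Dd (ball b 2^-1) _ (ball_open _ _).
    by exists b; exact: ballxx.
  by rewrite -ball_normE => -[/= xb Dx]; exists x.
have [f finj] := countable_injP _ Dc.
apply/countable_injP; exists (fun b => f (projT1 (near_pt b))) => b c.
rewrite !inE => Bb Bc.
case: (near_pt b) => x [Dx bx]; case: (near_pt c) => y [Dy cy] /=.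
move=> /finj; rewrite !inE => /(_ Dx Dy) xy; subst y.
apply/eqP/negP => /negP bc.
have : `|b - c| < 1.
  rewrite -(subrKA x) (le_lt_trans (ler_normD _ _)) //.
  by rewrite (distrC x c) [X in _ < X](splitr 1) div1r ltrD.
have : `|b - c| ^+ 2 = 2.
  by rewrite normB2 -!inner_norm !oB // !eqxx (negbTE bc) mulr0 subr0.
move=> h1 h2; have := normr_ge0 (b - c); nra.
Qed.

Lemma basis_seq_exists : separable H -> exists e, basis_seq e.
Proof.
move=> /countable_onb /countable_injP[f finj]; have [oB _] := onbP.
(* A partial inverse of the coding [f], with the default 0 at numbers that code no basis vector. *)
pose e n : H := xget 0 [set b | onb b /\ f b = n].
have eP i : (onb (e i) /\ f (e i) = i) \/ e i = 0.
  by rewrite /e; case: xgetP => [b -> [Bb fb]|_]; [left|right].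
exists e; split=> [|b Bb|i]; [split=> [i j ij|i]| |].
- have [[Bi fi]|->] := eP i; last by rewrite inner0l.
  have [[Bj fj]|->] := eP j; last by rewrite inner0r.
  rewrite oB //; case: eqP => // eij.
  by move: ij; rewrite -fi -fj eij eqxx.
- have [[Bi _]|->] := eP i; [left|by right].
  by apply/eqP; rewrite -sqrp_eq1 // -inner_norm oB // eqxx.
- have [Bc fc] : onb (e (f b)) /\ f (e (f b)) = f b.
    by apply: (@xgetPex _ 0 [set c | onb c /\ f c = f b]); exists b.
  by exists (f b); apply: finj; rewrite ?inE.
- by have [[]|] := eP i; [left|right].
Qed.

(** The Riesz-Fischer limit differs from [x] by a vector orthogonal to the whole basis, and
    maximality makes that vector 0. *)
Lemma basis_seq_cvg e x : basis_seq e ->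
  partial_proj e n x @[n --> \oo] --> x.
Proof.
move=> [oe eB _]; have [l pl xl] := partial_proj_cvg x oe.
suff lx : l = x by rewrite lx in pl.
apply/esym; apply/eqP; rewrite -subr_eq0; apply/eqP.
by have [_] := onbP; apply => b /eB[i <-].
Qed.

Lemma hs_normE e T : basis_seq e -> T 0 = 0 ->
  hs_norm T = sqrte (\sum_(i <oo) (`|T (e i)| ^+ 2)%:E)%E.
Proof.
move=> [oe eB Be] T0; rewrite /hs_norm; congr sqrte.
have -> : (onb : set H) = e @` [set i | e i != 0].
  apply/seteqP; split=> [b Bb|_ /= [i ei <-]].
    have [i ei] := eB _ Bb; exists i => //=; rewrite ei.
    apply/eqP => b0; have [/(_ _ _ Bb Bb)] := onbP.
    by rewrite b0 inner0l eqxx => /esym/eqP; rewrite oner_eq0.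
  by case: (Be i) => // ei0; rewrite ei0 eqxx in ei.
rewrite (esum_pred_image (fun b => (`|T b| ^+ 2)%:E) e (fun i => e i != 0)).
- rewrite eseries_mkcond; apply: eq_eseriesr => i _.
  by case: eqP => // ->; rewrite T0 normr0 expr0n.
- by move=> n _; rewrite lee_fin sqr_ge0.
- move=> i j /[!inE] ei ej eij; apply/eqP/negP => /negP ij.
  have [/(_ _ _ ij)] := oe.
  by rewrite -eij => /inner_eq0 e0 _; move: ei; rewrite e0 eqxx.
Qed.

(** With its converse below, this reduces Hilbert-Schmidt estimates to finite sums of real numbers.
    [T 0 = 0] silences the padded entries. *)
Lemma hs_norm_le e T (K : R) : basis_seq e -> T 0 = 0 -> 0 <= K ->
  (forall n, \sum_(i < n) `|T (e i)| ^+ 2 <= K ^+ 2) -> (hs_norm T <= K%:E)%E.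
Proof.
move=> eB T0 K0 TK; rewrite (hs_normE eB T0).
have -> : K%:E = sqrte (K ^+ 2)%:E by rewrite /= sqrtr_sqr ger0_norm.
rewrite lee_sqrt ?lee_fin ?sqr_ge0 //; apply: lime_le.
  by apply: is_cvg_nneseries => n _ _; rewrite lee_fin sqr_ge0.
by apply: nearW => n; rewrite sumEFin big_mkord lee_fin.
Qed.

Lemma hs_norm_ge e T (K : R) n : basis_seq e -> T 0 = 0 -> 0 <= K ->
  (hs_norm T <= K%:E)%E -> \sum_(i < n) `|T (e i)| ^+ 2 <= K ^+ 2.
Proof.
move=> eB T0 K0; rewrite (hs_normE eB T0).
have -> : K%:E = sqrte (K ^+ 2)%:E by rewrite /= sqrtr_sqr ger0_norm.
rewrite lee_sqrt ?lee_fin ?sqr_ge0 // => /(le_trans _) TK.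
rewrite -lee_fin; apply: TK; rewrite -sumEFin.
rewrite -(big_mkord xpredT (fun i => (`|T (e i)| ^+ 2)%:E)).
by apply: nneseries_lim_ge => i _ _; rewrite lee_fin sqr_ge0.
Qed.

End Basis.

(** * Orthogonal projections and the distance between subspaces *)

Section Projection.
Context {R : realType} {H : hilbertType R}.
Implicit Types (x y : H) (e f g : nat -> H).

(** [orth_proj] is a choice, so uniqueness is the point: two candidates differ by an element of the
    span that is orthogonal to the span, hence to itself. *)
Lemma orth_proj_span_first f p : orthoseq f ->
  orth_proj (span_first p f) = partial_proj f p.
Proof.
move=> oF; apply/funext => h; rewrite /orth_proj.
set A := [set v | _].
have Ap : A (partial_proj f p h).
  split; first by exists (fun i => inner (f i) h).
  move=> _ [c ->]; rewrite inner_suml big1 // => i _; rewrite innerZl innerBr.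
  by rewrite inner_orthoseq_partial_proj // ltn_ord subrr mulr0.
have [[c ->] cP] : A (get A) by apply: getPex; exists (partial_proj f p h).
case: Ap => -[c' p'] pP.
apply/eqP; rewrite -subr_eq0; apply/eqP/inner_eq0.
set u := _ - _.
have uS : span_first p f u.
  exists (fun i => c i - c' i); rewrite /u p' -sumrB.
  by apply: eq_bigr => i _; rewrite scalerBl.
rewrite {2}/u -[X in inner u X](subrKA h) innerDr -[X in inner u X + _]opprB.
by rewrite innerNr cP // pP // oppr0 addr0.
Qed.

Lemma partial_proj_is_linear f n : linear (partial_proj f n).
Proof.
move=> a x y; rewrite scaler_sumr -big_split; apply: eq_bigr => i _ /=.
by rewrite innerDr innerZr scalerDl scalerA.
Qed.

HB.instance Definition _ f n := GRing.isLinear.Build R H H *:%R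
  (partial_proj f n) (partial_proj_is_linear f n).

Lemma partial_proj_selfadj f n x y :
  inner (partial_proj f n x) y = inner x (partial_proj f n y).
Proof.
rewrite inner_partial_proj innerC inner_partial_proj.
by apply: eq_bigr => i _; rewrite mulrC.
Qed.

Lemma norm_lincomb_le p (c : 'I_p -> R) (u : 'I_p -> H) :
  `|\sum_i c i *: u i| ^+ 2 <= (\sum_i c i ^+ 2) * (\sum_i `|u i| ^+ 2).
Proof.
apply: le_trans (_ : (\sum_i `|c i| * `|u i|) ^+ 2 <= _).
  rewrite ler_sqr ?nnegrE //; last by apply: sumr_ge0 => i _; exact: mulr_ge0.
  by under [leRHS]eq_bigr do rewrite -normrZ; exact: ler_norm_sum.
under [X in _ <= X * _]eq_bigr do rewrite -real_normK ?num_real //.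
exact: CauchySchwarz_sum.
Qed.

(** The quantity bounded by [d] is the total squared distance of the [f j] from the span of the
    [g k], and also the reverse. In the factor [1 + p], the 1 comes from Bessel applied to the
    vectors [f j - G (f j)], the [p] from Cauchy-Schwarz over the [p] unit vectors [g k]. *)
Lemma rho_le e f g p (d : R) : basis_seq e -> orthoseq f -> orthoseq g ->
  (forall i, (i < p)%N -> `|f i| = 1) -> (forall i, (i < p)%N -> `|g i| = 1) ->
  p%:R - \sum_(j < p) \sum_(k < p) inner (f j) (g k) ^+ 2 <= d ->
  (rho (span_first p f) (span_first p g) <=
   (Num.sqrt (2 * (1 + p%:R) * d))%:E)%E.
Proof.
move=> eB oF oG f1 g1 dP; have oE : orthoseq e by case: eB.
have resid f' g' : orthoseq f' -> orthoseq g' ->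
    (forall i, (i < p)%N -> `|f' i| = 1) ->
    \sum_(j < p) `|f' j - partial_proj g' p (f' j)| ^+ 2 =
    p%:R - \sum_(j < p) \sum_(k < p) inner (f' j) (g' k) ^+ 2.
  move=> oF' oG' f'1.
  have -> : p%:R = \sum_(j < p) 1 :> R by rewrite sumr_const card_ord.
  rewrite -sumrB; apply: eq_bigr => j _.
  rewrite partial_proj_residual // f'1 // expr1n; congr (1 - _).
  by apply: eq_bigr => k _; rewrite innerC.
have d0 : 0 <= d.
  by apply: le_trans dP; rewrite -resid //; apply: sumr_ge0 => i _; exact: sqr_ge0.
rewrite /rho /hs_dist !orth_proj_span_first //.
apply: (hs_norm_le eB).
- by rewrite [LHS](_ : _ = partial_proj f p 0 - partial_proj g p 0) // !linear0 addr0.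
- exact: sqrtr_ge0.
move=> n; rewrite sqr_sqrtr ?mulr_ge0 // ?addr_ge0 //.
pose F := partial_proj f p; pose G := partial_proj g p.
(* [F - G = F (1 - G) - (1 - F) G]; the ranges are orthogonal, but the bound
   [|x - y|^2 <= 2 |x|^2 + 2 |y|^2] is enough. *)
have step i : `|F (e i) - G (e i)| ^+ 2 <=
    2 * (\sum_(j < p) inner (e i) (f j - G (f j)) ^+ 2) +
    2 * ((\sum_(k < p) inner (e i) (g k) ^+ 2) * d).
  have -> : F (e i) - G (e i) = F (e i - G (e i)) - (G (e i) - F (G (e i))).
    by rewrite [F (_ - _)]linearB opprB addrA addrNK.
  (* Self-adjointness of [G] moves [1 - G] from [e i] to [f j], which prepares Bessel in the basis
     index. *)
  have -> : \sum_(j < p) inner (e i) (f j - G (f j)) ^+ 2 =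
      `|F (e i - G (e i))| ^+ 2.
    rewrite norm_partial_proj //; apply: eq_bigr => j _.
    by rewrite !innerBr -partial_proj_selfadj !(innerC (f j)).
  have h : `|G (e i) - F (G (e i))| ^+ 2 <=
      (\sum_(k < p) inner (e i) (g k) ^+ 2) * d.
    have -> : G (e i) - F (G (e i)) =
        \sum_(k < p) inner (e i) (g k) *: (g k - F (g k)).
      have -> : G (e i) = \sum_(k < p) inner (e i) (g k) *: g k.
        by apply: eq_bigr => k _; rewrite innerC.
      rewrite [F _]linear_sum -sumrB; apply: eq_bigr => k _.
      by rewrite scalerBr; congr (_ - _); exact: linearZZ.
    apply: le_trans (norm_lincomb_le _ _) _.
    rewrite ler_wpM2l ?sumr_ge0 // => [k _|]; first exact: sqr_ge0.
    rewrite resid // exchange_big; apply: le_trans dP.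
    by under eq_bigr do under eq_bigr do rewrite innerC.
  have := sqr_ge0 `|F (e i - G (e i)) + (G (e i) - F (G (e i)))|.
  by rewrite normB2 normD2; lra.
apply: le_trans (ler_sum _ (fun (i : 'I_n) _ => step i)) _.
rewrite big_split /= -!mulr_sumr -mulr_suml.
rewrite exchange_big [X in _ + 2 * (X * _)]exchange_big /=.
have h1 : \sum_(j < p) \sum_(i < n) inner (e i) (f j - G (f j)) ^+ 2 <= d.
  by apply: le_trans dP; rewrite -resid //; apply: ler_sum => j _; exact: bessel.
have h2 : \sum_(k < p) \sum_(i < n) inner (e i) (g k) ^+ 2 <= p%:R.
  have -> : p%:R = \sum_(j < p) 1 :> R by rewrite sumr_const card_ord.
  apply: ler_sum => k _; apply: le_trans (bessel _ _ oE) _.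
  by rewrite g1 // expr1n.
nra.
Qed.

End Projection.

(** * Positive forms, Ky Fan's principle, uniform convergence *)

Section PositiveForms.
Context {R : realType} {H : hilbertType R}.
Implicit Types (x y h : H) (B : H -> H -> R) (C : H -> H) (e f phi : nat -> H).

(** The upper bound |x|^2 records that the forms come from unit random vectors; it is the same for
    all thresholds. *)
Definition psd_form B :=
  [/\ forall x y, B x y = B y x,
      forall a x y z, B (a *: x + y) z = a * B x z + B y z &
      forall x, 0 <= B x x <= `|x| ^+ 2].

Section Theory.
Variable B : H -> H -> R.
Hypothesis psdB : psd_form B.

Let formC x y : B x y = B y x.
Proof. by have [+ _ _] := psdB; exact. Qed.

Lemma formDl x y z : B (x + y) z = B x z + B y z.
Proof. by have [_ /(_ 1 x y z) + _] := psdB; rewrite scale1r mul1r. Qed.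

Lemma form0l x : B 0 x = 0.
Proof. by apply: (addrI (B 0 x)); rewrite -formDl !addr0. Qed.

Lemma formZl a x y : B (a *: x) y = a * B x y.
Proof. by have [_ /(_ a x 0 y) + _] := psdB; rewrite form0l !addr0. Qed.

Lemma formDr x y z : B x (y + z) = B x y + B x z.
Proof. by rewrite formC formDl !(formC x). Qed.

Lemma formZr a x y : B x (a *: y) = a * B x y.
Proof. by rewrite formC formZl (formC x). Qed.

Lemma formNl x y : B (- x) y = - B x y.
Proof. by rewrite -scaleN1r formZl mulN1r. Qed.

Lemma form_suml I (r : seq I) (Q : pred I) (F : I -> H) y :
  B (\sum_(i <- r | Q i) F i) y = \sum_(i <- r | Q i) B (F i) y.
Proof. by apply: (big_morph (B^~ y)) => [u v|]; rewrite ?formDl ?form0l. Qed.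

Lemma form_sumr I (r : seq I) (Q : pred I) (F : I -> H) y :
  B y (\sum_(i <- r | Q i) F i) = \sum_(i <- r | Q i) B y (F i).
Proof. by rewrite formC form_suml; apply: eq_bigr => i _; rewrite formC. Qed.

Lemma form_ge0 x : 0 <= B x x.
Proof. by have [_ _ /(_ x)/andP[]] := psdB. Qed.

Lemma form_le x : B x x <= `|x| ^+ 2.
Proof. by have [_ _ /(_ x)/andP[]] := psdB. Qed.

(** Cauchy-Schwarz for a semidefinite form in weighted form, free of square roots and of the
    degenerate case [B y y = 0]. It expands the form at [x - (c * s) *: y], where [s] is a sign. *)
Lemma form_amgm (c : R) x y : 0 < c -> 2 * `|B x y| <= c^-1 * B x x + c * B y y.
Proof.
move=> c0.
have key (s : R) : s * s = 1 -> 2 * s * B x y <= c^-1 * B x x + c * B y y.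
  move=> ss; have := form_ge0 (x - (c * s) *: y).
  rewrite formDl formNl formZl !formDr -scaleN1r !formZr (formC y x) => h.
  have -> : c^-1 * B x x + c * B y y =
      c^-1 * (B x x + c * c * (s * s) * B y y) by rewrite ss; field; rewrite gt_eqF.
  by rewrite ler_pdivlMl //; lra.
have := key 1 (mulr1 1); have := key (-1) (etrans (mulrNN 1 1) (mulr1 1)).
by case: (ger0P (B x y)) => _; lra.
Qed.

(** The difference equals [B (h - k) (h + k)], to which the weighted inequality applies; the 4
    bounds |h + k|^2. *)
Lemma form_near h k (s t : R) : 0 < s -> `|h| <= 1 -> `|k| <= 1 ->
  B (h - k) (h - k) <= t -> 2 * `|B h h - B k k| <= s^-1 * t + s * 4.
Proof.
move=> s0 h1 k1 hk.
have -> : B h h - B k k = B (h - k) (h + k).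
  by rewrite formDl formNl !formDr (formC k h); ring.
apply: le_trans (form_amgm _ _ s0) _; apply: lerD.
  by rewrite ler_wpM2l // invr_ge0 ltW.
rewrite ler_wpM2l ?(ltW s0) //; apply: le_trans (form_le _) _.
have : `|h + k| <= 2 by apply: le_trans (ler_normD _ _) _; lra.
by have := normr_ge0 (h + k); nra.
Qed.

Variables (C : H -> H) (lam : nat -> R) (phi : nat -> H).
Hypothesis CB : forall x y, inner x (C y) = B x y.
Hypothesis eigC : eigensystem C lam phi.

Lemma eigensystem_orthoseq : orthoseq phi.
Proof.
by case: eigC => o n _ _ _; split=> // i; case: (n i) => [|[]]; [left|right].
Qed.

Lemma form_eigen k x : B (phi k) x = lam k * inner (phi k) x.
Proof.
by have [_ _ Cphi _ _] := eigC; rewrite formC -CB Cphi innerZr innerC.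
Qed.

(** Expanding in eigenvectors, each eigenvalue from rank [p] on is at most [lam p], and Bessel
    bounds the mass it multiplies. The expansion is cut at a finite [n], at an arbitrarily small
    cost [d]. *)
Lemma form_le_eigen p h : B h h <=
  \sum_(k < p) lam k * inner (phi k) h ^+ 2 +
  lam p * (`|h| ^+ 2 - \sum_(k < p) inner (phi k) h ^+ 2).
Proof.
have oP := eigensystem_orthoseq.
have [_ _ _ [lam0 lamd] Cperp] := eigC.
have [l Pl lP] := partial_proj_cvg h oP.
apply/ler_addgt0Pr => d d0.
(* The square root appears because the form is bounded by a squared norm. The part [h - l] costs
   nothing: [C] vanishes on it. *)
have : \forall n \near \oo, (p <= n)%N /\ `|l - partial_proj phi n h| <= Num.sqrt d.
  near=> n; split; first by near: n; exists p.
  by near: n; apply: cvgr_dist_le => //; rewrite sqrtr_gt0.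
move=> [n _ /(_ _ (leqnn n))[pn ln]].
set q := partial_proj phi n h in ln.
have Cr x : B (h - l) x = 0 by rewrite formC -CB Cperp // inner0r.
have Bq x : B q x = \sum_(k < n) lam k * inner (phi k) h * inner (phi k) x.
  rewrite form_suml; apply: eq_bigr => k _.
  by rewrite formZl form_eigen; ring.
have Bqr : B q (h - q) = 0.
  rewrite Bq big1 // => k _.
  by rewrite innerBr inner_orthoseq_partial_proj // ltn_ord subrr mulr0.
have Bqq : B q q = \sum_(k < n) lam k * inner (phi k) h ^+ 2.
  rewrite Bq; apply: eq_bigr => k _.
  by rewrite inner_orthoseq_partial_proj // ltn_ord; ring.
have Brr : B (h - q) (h - q) <= d.
  have -> : h - q = (h - l) + (l - q) by rewrite subrKA.
  rewrite formDl Cr formDr [B _ (h - l)]formC Cr !add0r.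
  apply: le_trans (form_le _) _.
  by rewrite -[leRHS]sqr_sqrtr ?(ltW d0) // ler_sqr ?nnegrE // sqrtr_ge0.
have -> : B h h = B q q + B (h - q) (h - q).
  have -> : B h h = B (h - q + q) (h - q + q) by rewrite subrK.
  move: (h - q) Bqr => r Bqr.
  by rewrite formDl !formDr [B r q]formC Bqr; ring.
apply: lerD => //; rewrite Bqq.
have split_sum (F : nat -> R) :
    \sum_(k < n) F k = \sum_(k < p) F k + \sum_(p <= k < n) F k.
  by rewrite -!(big_mkord xpredT F) -big_cat_nat.
rewrite (split_sum (fun k => lam k * inner (phi k) h ^+ 2)) lerD2l.
apply: le_trans (_ : \sum_(p <= k < n) lam p * inner (phi k) h ^+ 2 <= _).
  rewrite big_nat_cond [leRHS]big_nat_cond; apply: ler_sum => k.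
  by rewrite andbT => /andP[pk _]; rewrite ler_wpM2r ?sqr_ge0 // lamd.
rewrite -mulr_sumr ler_wpM2l // lerBrDl.
by rewrite -(split_sum (fun k => inner (phi k) h ^+ 2)) bessel.
Unshelve. all: by end_near. Qed.

(* The quantitative form of Ky Fan's maximum principle. *)
Lemma eigen_gap p f : orthoseq f -> (forall j, (j < p)%N -> `|f j| = 1) ->
  (forall j, (j < p)%N -> `|phi j| = 1) ->
  (lam p.-1 - lam p) *
    (p%:R - \sum_(j < p) \sum_(k < p) inner (f j) (phi k) ^+ 2) <=
  \sum_(k < p) B (phi k) (phi k) - \sum_(j < p) B (f j) (f j).
Proof.
move=> oF f1 phi1; have oP := eigensystem_orthoseq.
have [_ _ _ [lam0 lamd] _] := eigC.
have pE : p%:R = \sum_(j < p) 1 :> R by rewrite sumr_const card_ord.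
have Bphi : \sum_(k < p) B (phi k) (phi k) = \sum_(k < p) lam k.
  apply: eq_bigr => k _.
  by rewrite form_eigen inner_norm phi1 // expr1n mulr1.
pose s k := \sum_(j < p) inner (phi k) (f j) ^+ 2.
have s1 (k : 'I_p) : s k <= 1.
  rewrite -[leRHS](expr1n _ 2) -(phi1 k) //; apply: le_trans (bessel p _ oF).
  by apply: ler_sum => j _; rewrite innerC.
have sE : \sum_(j < p) \sum_(k < p) inner (f j) (phi k) ^+ 2 = \sum_(k < p) s k.
  by rewrite exchange_big; apply: eq_bigr => k _; apply: eq_bigr => j _;
    rewrite innerC.
have Bf : \sum_(j < p) B (f j) (f j) <=
    \sum_(k < p) lam k * s k + lam p * (p%:R - \sum_(k < p) s k).
  apply: le_trans (ler_sum _ (fun (j : 'I_p) _ => form_le_eigen p (f j))) _.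
  rewrite big_split /= -mulr_sumr sumrB; under [X in _ + _ * (X - _)]eq_bigr do
    rewrite f1 // expr1n.
  rewrite -pE exchange_big [X in _ + _ * (_ - X)]exchange_big /= lerD2r.
  by apply: ler_sum => k _; rewrite mulr_sumr.
rewrite sE Bphi; apply: le_trans (lerB (lexx _) Bf).
(* Termwise the claim is [(lam p.-1 - lam p) * (1 - s k) <= (lam k - lam p) * (1 - s k)], where
   [1 - s k] is nonnegative. *)
rewrite pE -sumrB !mulr_sumr opprD addrA -!sumrB; apply: ler_sum => k _.
have : lam p.-1 <= lam k.
  by apply: lamd; rewrite -ltnS (leq_trans (ltn_ord k)) // leqSpred.
by have := s1 k; nra.
Qed.

(* A system padded before rank [p] spans a space of dimension below [p]. *)
Lemma eigensystem_unit p f : orthoseq f -> (forall j, (j < p)%N -> `|f j| = 1) ->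
  forall j, (j < p)%N -> `|phi j| = 1.
Proof.
move=> oF f1 j jp; have oP := eigensystem_orthoseq.
have [_ /(_ j)[//|[_ _ tot]] _ _ _] := eigC.
have fE k : (k < p)%N -> 1 = \sum_(i < j) inner (phi i) (f k) ^+ 2.
  move=> kp; rewrite -[LHS](expr1n _ 2) -(f1 k kp).
  apply/eqP; rewrite -subr_eq0 -partial_proj_residual // sqrf_eq0 normr_eq0.
  apply/eqP/tot => i ij.
  by rewrite innerBr inner_orthoseq_partial_proj // ij subrr.
(* Double counting of the squares [inner (phi i) (f k) ^+ 2]: for fixed [k] they sum to 1, for fixed
   [i] to at most 1. *)
have : p%:R <= j%:R :> R.
  have -> : p%:R = \sum_(k < p) 1 :> R by rewrite sumr_const card_ord.
  have -> : j%:R = \sum_(k < j) 1 :> R by rewrite sumr_const card_ord.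
  under eq_bigr => k _ do rewrite (fE k) //.
  rewrite exchange_big; apply: ler_sum => i _ /=.
  apply: le_trans (_ : `|phi i| ^+ 2 <= 1).
    by under eq_bigr do rewrite innerC; exact: bessel.
  by rewrite expr_le1 // orthoseq_norm_le1.
by rewrite ler_nat leqNgt jp.
Qed.

End Theory.

(** For the second moment of a unit vector Z, the right side is the mean squared distance of Z from
    the span of the first [n] vectors of [e]. Written with the trace, it involves only finitely many
    entries of [B]. *)
Definition tail_bound e B := forall n h, `|h| <= 1 ->
  B (h - partial_proj e n h) (h - partial_proj e n h) <=
  1 - \sum_(i < n) B (e i) (e i).

(** The forms are compared through the finite-rank part [q] of [h]: passing from [h] to [q] costs at
    most [3 * s] in each form, and at [q] they differ by at most [s ^+ 2 <= s]; in total [7 * s]. *)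
Lemma form_dist e B B' n (s : R) h : orthoseq e -> psd_form B -> psd_form B' ->
  tail_bound e B -> tail_bound e B' -> 0 < s <= 1 -> `|h| <= 1 ->
  \sum_(i < n) \sum_(j < n) `|B (e i) (e j) - B' (e i) (e j)| <= s ^+ 2 ->
  1 - \sum_(i < n) B' (e i) (e i) <= s ^+ 2 -> `|B h h - B' h h| <= 7 * s.
Proof.
move=> oE psdB psdB' tB tB' /andP[s0 s1] h1 BB' t'.
set q := partial_proj e n h.
have q1 : `|q| <= 1 by apply: le_trans (norm_partial_proj_le _ _ oE) h1.
have sI (u : R) : u <= 2 * s ^+ 2 -> s^-1 * u <= 2 * s.
  by move=> us; rewrite ler_pdivrMl // mulrCA -expr2.
(* Only the tail of [B'] is assumed small; that of [B] follows from the closeness of the diagonal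
   entries. *)
have t : 1 - \sum_(i < n) B (e i) (e i) <= 2 * s ^+ 2.
  have : \sum_(i < n) (B' (e i) (e i) - B (e i) (e i)) <= s ^+ 2.
    apply: le_trans BB'; apply: ler_sum => i _.
    rewrite (bigD1 i) //= -[leLHS]addr0 lerD ?sumr_ge0 //.
    by rewrite distrC ler_norm.
  by rewrite sumrB; lra.
have h2 := form_near psdB s0 h1 q1 (tB n h h1).
have h2' := form_near psdB' s0 h1 q1 (tB' n h h1).
have := sI _ t.
have : s^-1 * (1 - \sum_(i < n) B' (e i) (e i)) <= 2 * s.
  by apply: sI; have := sqr_ge0 s; lra.
have Bq b : psd_form b -> b q q = \sum_(i < n) \sum_(j < n)
    inner (e i) h * inner (e j) h * b (e i) (e j).
  move=> psd; rewrite (form_suml psd); apply: eq_bigr => i _.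
  rewrite (form_sumr psd); apply: eq_bigr => j _.
  by rewrite (formZl psd) (formZr psd); ring.
have h3 : `|B q q - B' q q| <= s.
  apply: le_trans (_ : s ^+ 2 <= s); last by rewrite expr2; nra.
  apply: le_trans BB'; rewrite !Bq // -sumrB.
  apply: le_trans (ler_norm_sum _ _ _) _; apply: ler_sum => i _.
  rewrite -sumrB; apply: le_trans (ler_norm_sum _ _ _) _; apply: ler_sum => j _.
  rewrite -mulrBr normrM ler_piMl // normrM.
  have c1 k : `|inner (e k) h| <= 1.
    apply: le_trans (CauchySchwarz_inner _ _) _.
    by rewrite mulr_ile1 // orthoseq_norm_le1.
  by rewrite mulr_ile1.
have -> : B h h - B' h h = (B h h - B q q) + (B q q - B' q q) - (B' h h - B' q q).
  by ring.
move=> a b; apply: le_trans (ler_normB _ _) _.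
have := ler_normD (B h h - B q q) (B q q - B' q q).
by lra.
Qed.

(** The rank [n] is fixed by the trace of the limit form alone; after that only [n * n] entries of
    [B t] have to be close to their limits. *)
Lemma form_cvg_uniform e (F : set_system R) (B : R -> H -> H -> R) B' :
  ProperFilter F -> orthoseq e -> psd_form B' -> tail_bound e B' ->
  (\forall t \near F, psd_form (B t) /\ tail_bound e (B t)) ->
  (forall i j, B t (e i) (e j) @[t --> F] --> B' (e i) (e j)) ->
  \sum_(i < n) B' (e i) (e i) @[n --> \oo] --> (1 : R) ->
  forall s, 0 < s ->
  \forall t \near F, forall h, `|h| <= 1 -> `|B t h h - B' h h| <= s.
Proof.
move=> FF oE psdB' tB' psdB Bcvg B'1 s s0.
(* The tolerance for [form_dist], whose bound is [7 * r] and which asks for [r <= 1]. *)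
pose r := Num.min (s / 7) 1.
have r0 : 0 < r by rewrite lt_min divr_gt0 ?ltr01.
have r1 : r <= 1 by rewrite ge_min lexx orbT.
have rs : 7 * r <= s by rewrite mulrC -ler_pdivlMr // ge_min lexx.
have [n Bn] : exists n, 1 - \sum_(i < n) B' (e i) (e i) <= r ^+ 2.
  have /cvgrPdist_le/(_ (r ^+ 2)) := B'1.
  rewrite exprn_gt0 // => /(_ isT)[n _ /(_ _ (leqnn n)) /= nr].
  by exists n; apply: le_trans nr; exact: ler_norm.
near=> t => h h1; apply: le_trans rs.
have [psdt tt] : psd_form (B t) /\ tail_bound e (B t) by near: t.
apply: (form_dist oE psdt psdB' tt tB' _ h1 _ Bn); first by rewrite r0.
near: t.
have : \sum_(i < n) \sum_(j < n) `|B t (e i) (e j) - B' (e i) (e j)| @[t --> F]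
    --> \sum_(i < n) \sum_(j < n) (0 : R).
  apply: cvg_big => [|i _]; first exact: add_continuous.
  apply: cvg_big => [|j _]; first exact: add_continuous.
  rewrite -(normr0 R^o) -(subrr (B' (e i) (e j))).
  by apply: cvg_norm; apply: cvgB => //; exact: cvg_cst.
under eq_bigr do rewrite big1 //.
rewrite big1 // => /cvgr0Pnorm_le/(_ (r ^+ 2)).
rewrite exprn_gt0 // => /(_ isT); apply: filterS => t.
by apply: le_trans; exact: ler_norm.
Unshelve. all: by end_near. Qed.

End PositiveForms.

Lemma continuous_borel_measurable (R : realType) (H : hilbertType R) (g : H -> R) :
  continuous g -> measurable_fun [set: borel H] (g : borel H -> R).
Proof.
move=> /continuousP cg; apply: (measurability _ (RGenOInfty.measurableE R)).
move=> _ [_ [a ->] <-]; rewrite setTI; apply: sub_sigma_algebra.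
exact/cg/interval_open.
Qed.

Lemma measurable_unit_sphere (R : realType) (H : hilbertType R) :
  measurable (unit_sphere : set (borel H)).
Proof.
have mn : measurable_fun [set: borel H] (fun x : borel H => `|x : H|).
  by apply: continuous_borel_measurable; exact: norm_continuous.
have := mn measurableT [set 1] (measurable_set1 _); rewrite setTI.
by congr measurable.
Qed.

(* No measurability is assumed: the Lebesgue integral is a supremum over simple
   functions. *)
Lemma ge0_le_integral_sup d (T : measurableType d) (R : realType)
    (mu : {measure set T -> \bar R}) (f g : T -> \bar R) :
  (forall w, 0 <= f w)%E -> (forall w, f w <= g w)%E ->
  (\int[mu]_w f w <= \int[mu]_w g w)%E.
Proof.
move=> f0 fg; have g0 w : (0 <= g w)%E by apply: le_trans (fg w).
rewrite !ge0_integralTE //; apply: le_ereal_sup => _ [h hf <-].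
by exists h => // w; apply: le_trans (fg w).
Qed.

(** * Expectations under a measure carried by a set [D] of mass 1 *)

Section Expectation.
Context d (T : measurableType d) (R : realType).
Variables (mu : {measure set T -> \bar R}) (D : set T).
Hypotheses (mD : measurable D) (D1 : mu D = 1%E) (DC0 : mu (~` D) = 0%E).
Implicit Types (f g : T -> R).

Definition expect f : R := \int[mu]_(w in D) f w.

(** Boundedness is asked on the carrier [D] only: off the sphere, a null set, the random vector may
    be unbounded. *)
Definition bdd_measurable f :=
  measurable_fun [set: T] f /\ exists M : R, forall w, D w -> `|f w| <= M.

Lemma bdd_measurable_integrable f :
  bdd_measurable f -> mu.-integrable D (EFin \o f).
Proof.
move=> [mf [M fM]]; apply: measurable_bounded_integrable => //.
- by rewrite D1 ltry.
- exact: measurable_funS mf.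
- exists M; split; first exact: num_real.
  by move=> N MN w Dw; apply: le_trans (fM w Dw) (ltW MN).
Qed.

Lemma bdd_measurable_cst c : bdd_measurable (fun=> c).
Proof. by split; [exact: measurable_cst|exists `|c|]. Qed.

Lemma bdd_measurableD f g : bdd_measurable f -> bdd_measurable g ->
  bdd_measurable (fun w => f w + g w).
Proof.
move=> [mf [M fM]] [mg [N gN]]; split; first exact: measurable_funD.
by exists (M + N) => w Dw; rewrite (le_trans (ler_normD _ _)) // lerD ?fM ?gN.
Qed.

Lemma bdd_measurableM f g : bdd_measurable f -> bdd_measurable g ->
  bdd_measurable (fun w => f w * g w).
Proof.
move=> [mf [M fM]] [mg [N gN]]; split; first exact: measurable_funM.
by exists (M * N) => w Dw; rewrite normrM ler_pM ?fM ?gN.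
Qed.

Lemma bdd_measurableZ c f : bdd_measurable f -> bdd_measurable (fun w => c * f w).
Proof. by apply: bdd_measurableM; exact: bdd_measurable_cst. Qed.

Lemma bdd_measurableB f g : bdd_measurable f -> bdd_measurable g ->
  bdd_measurable (fun w => f w - g w).
Proof.
move=> bf /(bdd_measurableZ (-1)) bg.
by under eq_fun do rewrite -mulN1r; exact: bdd_measurableD.
Qed.

Lemma bdd_measurable_norm f : bdd_measurable f -> bdd_measurable (fun w => `|f w|).
Proof.
move=> [mf [M fM]]; split; first exact: measurableT_comp.
by exists M => w Dw; rewrite normr_id fM.
Qed.

Lemma bdd_measurable_sum I (s : seq I) (f : I -> T -> R) :
  (forall i, bdd_measurable (f i)) ->
  bdd_measurable (fun w => \sum_(i <- s) f i w).
Proof.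
move=> bf; elim: s => [|i s IH].
  by under eq_fun do rewrite big_nil; exact: bdd_measurable_cst.
by under eq_fun do rewrite big_cons; exact: bdd_measurableD.
Qed.

Lemma expectD f g : bdd_measurable f -> bdd_measurable g ->
  expect (fun w => f w + g w) = expect f + expect g.
Proof. by move=> bf bg; apply: RintegralD => //; exact: bdd_measurable_integrable. Qed.

Lemma expectB f g : bdd_measurable f -> bdd_measurable g ->
  expect (fun w => f w - g w) = expect f - expect g.
Proof. by move=> bf bg; apply: RintegralB => //; exact: bdd_measurable_integrable. Qed.

Lemma expectZ c f : bdd_measurable f -> expect (fun w => c * f w) = c * expect f.
Proof. by move=> bf; apply: RintegralZl => //; exact: bdd_measurable_integrable. Qed.

Lemma expect_cst c : expect (fun=> c) = c.
Proof. by rewrite /expect Rintegral_cst // D1 /= mulr1. Qed.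

Lemma expect_sum I (s : seq I) (f : I -> T -> R) :
  (forall i, bdd_measurable (f i)) ->
  expect (fun w => \sum_(i <- s) f i w) = \sum_(i <- s) expect (f i).
Proof.
move=> bf; elim: s => [|i s IH].
  by under eq_fun do rewrite big_nil; rewrite expect_cst big_nil.
under eq_fun do rewrite big_cons.
by rewrite expectD ?IH ?big_cons //; exact: bdd_measurable_sum.
Qed.

Lemma le_expect f g : bdd_measurable f -> bdd_measurable g ->
  (forall w, D w -> f w <= g w) -> expect f <= expect g.
Proof. by move=> bf bg; apply: le_Rintegral => //; exact: bdd_measurable_integrable. Qed.

Lemma eq_expect f g : (forall w, D w -> f w = g w) -> expect f = expect g.
Proof. by move=> fg; apply: eq_Rintegral => w; rewrite inE; exact: fg. Qed.

Lemma norm_expect f : bdd_measurable f -> `|expect f| <= expect (fun w => `|f w|).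
Proof.
by move=> bf; apply: le_normr_Rintegral => //; exact: bdd_measurable_integrable.
Qed.

Lemma expect_EFin f : bdd_measurable f ->
  (expect f)%:E = (\int[mu]_(w in D) (f w)%:E)%E.
Proof.
move=> /bdd_measurable_integrable bf.
by rewrite /expect /Rintegral fineK //; exact: integrable_fin_num.
Qed.

(** Links the definition of the Bochner integral, which integrates over all of [T], to [expect],
    which sees only [D]. *)
Lemma ge0_expect_setT f : bdd_measurable f -> (forall w, 0 <= f w) ->
  (\int[mu]_w (f w)%:E)%E = (expect f)%:E.
Proof.
move=> bf f0; rewrite expect_EFin //.
rewrite (@ge0_negligible_integral _ _ _ _ setT (~` D)) //.
- by rewrite setTD setCK.
- exact: measurableC.
- by apply/measurable_EFinP; case: bf.
- by move=> w _; rewrite lee_fin.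
Qed.

Lemma expect_indic A : measurable A -> expect (\1_A) = fine (mu A).
Proof.
move=> mA; rewrite /expect /Rintegral integral_indic //; congr fine.
have eA : A = (A `&` D) `|` (A `\` D) by rewrite setDE -setIUr setUv setIT.
have z : mu (A `\` D) = 0%E.
  apply: (@subset_measure0 _ _ _ _ _ (~` D)) => //.
  - exact: measurableD.
  - exact: measurableC.
have -> : mu A = mu ((A `&` D) `|` (A `\` D)) by rewrite -eA.
rewrite measureU //; last by rewrite setDE setIACA setICr setI0.
- by rewrite [X in (_ + X)%E](_ : _ = 0%E) ?adde0.
- exact: measurableI.
- exact: measurableD.
Qed.

Lemma expect_cvg (f_ : nat -> T -> R) f (M : R) :
  (forall n, measurable_fun [set: T] (f_ n)) -> measurable_fun [set: T] f ->
  (forall n w, D w -> `|f_ n w| <= M) ->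
  (forall w, D w -> f_ n w @[n --> \oo] --> f w) ->
  expect (f_ n) @[n --> \oo] --> expect f.
Proof.
move=> mf_ mf f_M f_f.
have [|||||iF _ F] := @dominated_convergence _ _ _ mu D mD
    (fun n w => (f_ n w)%:E) (fun w => (f w)%:E) (fun=> M%:E).
- by move=> n; apply/measurable_EFinP; exact: measurable_funS (mf_ n).
- by apply/measurable_EFinP; exact: measurable_funS mf.
- apply: aeW => w Dw; apply: cvg_EFin; first exact: nearW.
  exact: f_f.
- apply: bdd_measurable_integrable; exact: bdd_measurable_cst.
- by apply: aeW => w n Dw /=; rewrite lee_fin f_M.
apply: fine_cvg; rewrite [X in _ --> X](_ : _ = \int[mu]_(w in D) (f w)%:E)%E //.
by rewrite /Rintegral fineK //; exact: integrable_fin_num iF.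
Qed.

End Expectation.

(** * Hilbert-Schmidt operators and rank-one tensors *)

Section HilbertSchmidtOperators.
Context {R : realType} {H : hilbertType R}.
Implicit Types (x y z u v : H) (S T : H -> H) (e : nat -> H).

Definition linear_continuous T := linear T /\ continuous T.

Lemma linear_continuous0 T : linear_continuous T -> T 0 = 0.
Proof.
case=> /(_ 1 0 0) + _; rewrite !scale1r addr0 => /esym/eqP.
by rewrite -subr_eq0 addrK => /eqP.
Qed.

Lemma linear_continuousB S T : linear_continuous S -> linear_continuous T ->
  linear_continuous (S - T).
Proof.
move=> [lS cS] [lT cT]; split=> [a x y|x]; last exact: (cvgB (cS x) (cT x)).
change (S (a *: x + y) - T (a *: x + y) = a *: (S x - T x) + (S y - T y)).
by rewrite lS lT scalerBr opprD addrACA.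
Qed.

Lemma hs_operator_linear_continuous T : hs_operator T -> linear_continuous T.
Proof. by case. Qed.

Lemma linear_continuous_lincomb T n (c : 'I_n -> R) (f : 'I_n -> H) :
  linear_continuous T ->
  T (\sum_(i < n) c i *: f i) = \sum_(i < n) c i *: T (f i).
Proof.
move=> lT; have [linT _] := lT.
have TD x y : T (x + y) = T x + T y by have := linT 1 x y; rewrite !scale1r.
have TZ a x : T (a *: x) = a *: T x.
  by have := linT a x 0; rewrite (linear_continuous0 lT) !addr0.
rewrite (big_morph T TD (linear_continuous0 lT)).
by apply: eq_bigr => i _; exact: TZ.
Qed.

(** The operator norm is below the Hilbert-Schmidt norm: Cauchy-Schwarz on partial expansions of
    [y], then continuity of [T]. *)
Lemma norm_le_hs e T (K : R) y : basis_seq e -> linear_continuous T -> 0 <= K ->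
  (hs_norm T <= K%:E)%E -> `|T y| <= K * `|y|.
Proof.
move=> eB lT K0 TK; have oE : orthoseq e by case: eB.
have Tp n : `|T (partial_proj e n y)| <= K * `|y|.
  rewrite linear_continuous_lincomb // -ler_sqr ?nnegrE ?mulr_ge0 //.
  apply: le_trans (norm_lincomb_le _ _) _; rewrite exprMn mulrC.
  apply: ler_pM; rewrite ?bessel //.
  - by apply: sumr_ge0 => i _; exact: sqr_ge0.
  - by apply: sumr_ge0 => i _; exact: sqr_ge0.
  - exact: hs_norm_ge (linear_continuous0 lT) K0 TK.
have Tc : T (partial_proj e n y) @[n --> \oo] --> T y.
  by have [_ cT] := lT; apply: continuous_cvg; [exact: cT|exact: basis_seq_cvg].
apply/ler_addgt0Pr => s s0.
have /cvgrPdist_le/(_ _ s0)[n _ /(_ _ (leqnn n)) /= ns] := Tc.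
rewrite -(subrK (T (partial_proj e n y)) (T y)) (le_trans (ler_normD _ _)) //.
by rewrite addrC lerD.
Qed.

Lemma tensor_linear_continuous u v : linear_continuous (tensor u v).
Proof.
split=> [a x y|]; first by rewrite /tensor innerDr innerZr scalerDl scalerA.
apply: (@bounded_linear_continuous _ _ _ _ (`|u| * `|v|)) => x.
  by move=> y; rewrite /tensor innerBr scalerBl.
by rewrite /tensor normrZ mulrAC ler_wpM2r // CauchySchwarz_inner.
Qed.

Lemma tensor_hs_operator e u v : basis_seq e -> hs_operator (tensor u v).
Proof.
move=> eB; have lT := tensor_linear_continuous u v.
have oE : orthoseq e by case: eB.
split; [by case: lT|by case: lT|].
apply: (@le_lt_trans _ _ (`|u| * `|v|)%:E); last exact: ltry.
apply: (hs_norm_le eB); rewrite ?mulr_ge0 ?linear_continuous0 // => n.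
under eq_bigr do rewrite /tensor normrZ exprMn real_normK ?num_real //.
rewrite -mulr_suml exprMn ler_wpM2r ?sqr_ge0 //.
by under eq_bigr do rewrite innerC; exact: bessel.
Qed.

(** The difference of tensors at h is <z - v, h> z + <v, h> (z - v). Bessel on both terms gives the
    factor 2 + 2 * 4 = 10, rounded up to 16 = 4^2. *)
Lemma tensorB_sum_le e n z v : orthoseq e -> `|v| <= 2 * `|z| ->
  \sum_(i < n) `|tensor z z (e i) - tensor v v (e i)| ^+ 2 <=
  (4 * (`|z| * `|z - v|)) ^+ 2.
Proof.
move=> oE vz.
have step i : `|tensor z z (e i) - tensor v v (e i)| ^+ 2 <=
    2 * (inner (e i) (z - v) ^+ 2 * `|z| ^+ 2) +
    2 * (inner (e i) v ^+ 2 * `|z - v| ^+ 2).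
  have -> : tensor z z (e i) - tensor v v (e i) =
      inner (e i) (z - v) *: z + inner (e i) v *: (z - v).
    rewrite /tensor !(innerC (e i)) innerBl scalerBl scalerBr.
    by rewrite addrA subrK.
  have -> : inner (e i) (z - v) ^+ 2 * `|z| ^+ 2 = `|inner (e i) (z - v) *: z| ^+ 2.
    by rewrite normrZ exprMn real_normK ?num_real.
  have -> : inner (e i) v ^+ 2 * `|z - v| ^+ 2 = `|inner (e i) v *: (z - v)| ^+ 2.
    by rewrite normrZ exprMn real_normK ?num_real.
  move: (inner (e i) (z - v) *: z) (inner (e i) v *: (z - v)) => a b.
  by have := sqr_ge0 `|a - b|; rewrite normB2 normD2; lra.
apply: le_trans (ler_sum _ (fun (i : 'I_n) _ => step i)) _.
rewrite big_split /= -!mulr_sumr -!mulr_suml.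
have h1 := bessel n (z - v) oE; have h2 := bessel n v oE.
have h3 : `|v| ^+ 2 <= 4 * `|z| ^+ 2 by have := normr_ge0 v; nra.
have h4 : (\sum_(i < n) inner (e i) (z - v) ^+ 2) * `|z| ^+ 2 <=
  `|z - v| ^+ 2 * `|z| ^+ 2 by rewrite ler_wpM2r ?sqr_ge0.
have h5 : (\sum_(i < n) inner (e i) v ^+ 2) * `|z - v| ^+ 2 <=
    (4 * `|z| ^+ 2) * `|z - v| ^+ 2.
  by rewrite ler_wpM2r ?sqr_ge0 // (le_trans h2).
have h6 : 0 <= `|z - v| ^+ 2 * `|z| ^+ 2 by rewrite mulr_ge0 ?sqr_ge0.
rewrite !exprMn; lra.
Qed.

Lemma hs_dist_tensor_le e z v : basis_seq e -> `|v| <= 2 * `|z| ->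
  (hs_dist (tensor z z) (tensor v v) <= (4 * (`|z| * `|z - v|))%:E)%E.
Proof.
move=> eB vz; apply: (hs_norm_le eB); rewrite ?mulr_ge0 //.
  by apply/linear_continuous0/linear_continuousB; exact: tensor_linear_continuous.
by move=> n; apply: tensorB_sum_le => //; case: eB.
Qed.

End HilbertSchmidtOperators.

(** * Measurable finite-valued approximation by nearest points *)

Section NearestPoint.
Context {R : realType} {H : hilbertType R}.
Variable a : nat -> H.

(** Starting the competition at 0 keeps the error below |z|, hence the approximant below 2 |z|,
    whatever the sequence [a]. *)
Fixpoint nearest n (z : H) : H :=
  if n is m.+1 then
    if `|z - a m| < `|z - nearest m z| then a m else nearest m z
  else 0.

Lemma nearest_dist_le n z : `|z - nearest n z| <= `|z|.
Proof.
elim: n => [|n IH] /=; first by rewrite subr0.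
by case: ifPn => // /ltW/le_trans; exact.
Qed.

Lemma nearest_norm_le n z : `|nearest n z| <= 2 * `|z|.
Proof.
rewrite -[X in `|X| <= _](subKr z) (le_trans (ler_normB _ _)) //.
by have := nearest_dist_le n z; lra.
Qed.

Lemma nearest_dist_nincr m n z : (m <= n)%N ->
  `|z - nearest n z| <= `|z - nearest m z|.
Proof.
elim: n => [|n IH]; first by rewrite leqn0 => /eqP ->.
rewrite leq_eqVlt => /predU1P[->//|/IH h] /=.
by case: ifPn => // /ltW/le_trans; exact.
Qed.

Lemma nearest_dist_point m n z : (m < n)%N -> `|z - nearest n z| <= `|z - a m|.
Proof.
move=> mn; apply: le_trans (nearest_dist_nincr z mn) _ => /=.
by case: ltP.
Qed.

Lemma nearest_cvg z : dense (range a) ->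
  `|z - nearest n z| @[n --> \oo] --> (0 : R).
Proof.
move=> da; apply/cvgr0Pnorm_lt => s s0.
have [x [zx [m _ xE]]] : ball z s `&` range a !=set0.
  by apply: da; [exists z; exact: ballxx|exact: ball_open].
move: zx; rewrite -xE -ball_normE /= => zm; exists m.+1 => // n /= mn.
by rewrite normr_id (le_lt_trans (nearest_dist_point z mn)).
Qed.

Lemma finite_range_nearest n : finite_set (range (nearest n)).
Proof.
elim: n => [|n IH].
  apply: (@sub_finite_set _ _ [set 0]); last exact: finite_set1.
  by move=> _ [z _ <-].
apply: (@sub_finite_set _ _ (range (nearest n) `|` [set a n])).
  by move=> _ [z _ <-] /=; case: ifP => _; [right|left; exists z].
by rewrite finite_setU; split.
Qed.

Context d (T : measurableType d) (Z : T -> borel H).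
Hypothesis mZ : measurable_fun [set: T] Z.

Lemma measurable_dist_point (x : H) :
  measurable_fun [set: T] (fun w => `|(Z w : H) - x|).
Proof.
apply: (@measurableT_comp _ _ _ _ _ _ (fun z : borel H => `|(z : H) - x|)) => //.
apply: continuous_borel_measurable => z.
apply: cvg_norm; apply: cvgB; [exact: cvg_id|exact: cvg_cst].
Qed.

Lemma measurable_dist_nearest n :
  measurable_fun [set: T] (fun w => `|(Z w : H) - nearest n (Z w)|).
Proof.
elim: n => [|n IH]; first exact: measurable_dist_point.
rewrite (_ : (fun w => _) = (fun w =>
    Num.min `|(Z w : H) - a n| `|(Z w : H) - nearest n (Z w)|)).
  by apply: measurable_minr => //; exact: measurable_dist_point.
by apply/funext => w /=; rewrite minEle; case: ltgtP => // ->.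
Qed.

(** [A] need not be Borel: finitely many values are taken, each on a measurable piece. This yields
    measurable fibres for maps into operators, where no sigma-algebra is fixed. *)
Lemma measurable_nearest n (A : set H) :
  measurable ((fun w => nearest n (Z w)) @^-1` A).
Proof.
elim: n => [|n IH] /=.
  have [A0|A0] := pselect (A 0).
    by rewrite (_ : _ @^-1` _ = setT) //; apply/seteqP; split.
  by rewrite (_ : _ @^-1` _ = set0) //; apply/seteqP; split.
pose B := [set w | `|(Z w : H) - a n| < `|(Z w : H) - nearest n (Z w)|].
have mB : measurable B.
  have := measurable_fun_ltr (measurable_dist_point (a n))
    (measurable_dist_nearest n) measurableT (I : measurable [set true]).
  by rewrite setTI; congr measurable.
rewrite (_ : _ @^-1` _ = (B `&` [set _ | A (a n)]) `|`
    (~` B `&` ((fun w => nearest n (Z w)) @^-1` A))).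
  apply: measurableU; apply: measurableI => //; last exact: measurableC.
  have [An|An] := pselect (A (a n)).
    by rewrite (_ : [set _ | _] = setT) //; apply/seteqP; split.
  by rewrite (_ : [set _ | _] = set0) //; apply/seteqP; split.
apply/seteqP; split=> [w|w] /=.
  by case: ifPn => [wB|/negP wB] Aw; [left|right].
by move=> [[-> //]|[/negP/negbTE ->]].
Qed.

End NearestPoint.

Lemma separable_dense_seq (T : ptopologicalType) : separable T ->
  exists a : nat -> T, dense (range a).
Proof.
move=> [D Dc Dd].
have [f finj] := countable_injP _ Dc.
exists (fun n => xget point [set x | D x /\ f x = n]) => O O0 Oo.
have [x [Ox Dx]] := Dd O O0 Oo.
exists x; split=> //; exists (f x) => //.
apply: xget_unique => //= y [Dy /finj]; rewrite !inE; exact.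
Qed.

Lemma squeeze_cvge0 (R : realType) (u : nat -> \bar R) (f : nat -> R) :
  (forall n, 0 <= u n)%E -> (forall n, u n <= (f n)%:E)%E ->
  f n @[n --> \oo] --> (0 : R) -> u n @[n --> \oo] --> 0%E.
Proof.
move=> u0 uf f0; apply: (@squeeze_cvge _ _ _ _ (cst 0%E) _ (fun n => (f n)%:E)).
- by apply: nearW => n; rewrite u0 uf.
- exact: cvg_cst.
- by apply: cvg_EFin => //; exact: nearW.
Qed.

(** * Integrals of simple operator-valued functions *)

Section SimpleOperators.
Context {R : realType} {H : hilbertType R} d (T : measurableType d).
Variables (mu : {measure set T -> \bar R}) (D : set T).
Hypotheses (mD : measurable D) (D1 : mu D = 1%E) (DC0 : mu (~` D) = 0%E).
Variable s : T -> H -> H.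
Hypothesis ss : hs_simple s.

Let range_seq : exists2 r : seq (H -> H), uniq r & range s = [set` r].
Proof.
have [/finite_seqP[r rE] _ _] := ss.
exists (undup r); first exact: undup_uniq.
by rewrite rE; apply/seteqP; split=> S /=; rewrite mem_undup.
Qed.

Let mpre S : measurable (s @^-1` [set S]). Proof. by case: ss. Qed.

Let hs_simple_sumE (r : seq (H -> H)) (g : (H -> H) -> R) w :
  uniq r -> range s = [set` r] ->
  g (s w) = \sum_(S <- r) g S * \1_(s @^-1` [set S]) w.
Proof.
move=> ur rE; have sw : s w \in r.
  by have : range s (s w) by [exists w]; rewrite rE.
rewrite (bigD1_seq (s w) sw) //= indicE mem_set // mulr1 big1 ?addr0 // => S Sw.
by rewrite indicE memNset ?mulr0 // => wS; rewrite wS eqxx in Sw.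
Qed.

Let bdd_indic A : measurable A -> bdd_measurable D (\1_A : T -> R).
Proof.
move=> mA; split; first exact: measurable_indic.
by exists 1 => w _; rewrite indicE; case: (_ \in _); rewrite ?normr0 ?normr1.
Qed.

(** Any [g] is allowed, since composing it with [s] gives a finite combination of indicators of
    fibres. *)
Lemma hs_simple_bdd_measurable (g : (H -> H) -> R) :
  bdd_measurable D (fun w => g (s w)).
Proof.
have [r ur rE] := range_seq.
under eq_fun do rewrite (hs_simple_sumE _ _ ur rE).
by apply: bdd_measurable_sum => S; apply: bdd_measurableZ; exact: bdd_indic.
Qed.

Lemma inner_simple_integral x y :
  inner x (simple_integral mu s y) = expect mu D (fun w => inner x (s w y)).
Proof.
have [r ur rE] := range_seq.
rewrite /simple_integral rE -fsbig_seq // fct_sumE inner_sumr.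
rewrite (@eq_expect _ _ _ _ _ _ (fun w =>
    \sum_(S <- r) inner x (S y) * \1_(s @^-1` [set S]) w)); last first.
  by move=> w _; rewrite (hs_simple_sumE (fun S => inner x (S y)) _ ur rE).
rewrite expect_sum //; last first.
  by move=> S; apply: bdd_measurableZ; exact: bdd_indic.
apply: eq_bigr => S _; rewrite expectZ //; last exact: bdd_indic.
by rewrite expect_indic // innerZr mulrC.
Qed.

Lemma simple_integral_linear_continuous :
  linear_continuous (simple_integral mu s).
Proof.
have [r ur rE] := range_seq; rewrite /simple_integral rE -fsbig_seq //=.
have : forall S, S \in r -> linear_continuous S.
  move=> S Sr; have [w _ <-] : range s S by rewrite rE.
  by apply: hs_operator_linear_continuous; case: ss.
elim: r {ur rE} => [|S r IH] lr.
  by rewrite big_nil; split=> [a x y|x]; [rewrite scaler0 addr0|exact: cvg_cst].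
rewrite big_cons.
have [lS cS] := lr S (mem_head _ _).
have [lr' cr] : linear_continuous
    (\sum_(i <- r) fine (mu (s @^-1` [set i])) *: i).
  by apply: IH => S' Sr; apply: lr; rewrite inE Sr orbT.
move: (\sum_(i <- r) _) (fine _) lr' cr => U c lU cU.
split=> [a x y|x].
  change (c *: S (a *: x + y) + U (a *: x + y) =
          a *: (c *: S x + U x) + (c *: S y + U y)).
  by rewrite lS lU !scalerDr !scalerA (mulrC a) addrACA.
by apply: cvgD; [apply: cvgZr; exact: cS|exact: cU].
Qed.

End SimpleOperators.

(** * Second moments and the Bochner integral of the tensor square *)

Section SecondMoment.
Context {R : realType} {H : hilbertType R} d (T : measurableType d).
Variables (mu : {measure set T -> \bar R}) (Z : T -> borel H).
Hypothesis mZ : measurable_fun [set: T] Z.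

Definition on_sphere := Z @^-1` unit_sphere.
Local Notation D := on_sphere.

Hypotheses (D1 : mu D = 1%E) (DC0 : mu (~` D) = 0%E).

Definition second_moment (x y : H) : R :=
  expect mu D (fun w => inner (Z w : H) x * inner (Z w : H) y).

Local Notation B := second_moment.

Let mD : measurable D.
Proof.
by have := mZ measurableT (@measurable_unit_sphere R H); rewrite setTI.
Qed.

Let bdd_inner x : bdd_measurable D (fun w => inner (Z w : H) x).
Proof.
split.
  apply: (@measurableT_comp _ _ _ _ _ _ (fun z : borel H => inner (z : H) x)) => //.
  by apply: continuous_borel_measurable; exact: inner_continuousl.
by exists `|x| => w Dw; rewrite (le_trans (CauchySchwarz_inner _ _)) // Dw mul1r.
Qed.

Let bddM x y :
  bdd_measurable D (fun w => inner (Z w : H) x * inner (Z w : H) y).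
Proof. exact: bdd_measurableM. Qed.

Lemma psd_second_moment : psd_form B.
Proof.
split=> [x y|a x y z|x].
- by apply: eq_expect => w _; rewrite mulrC.
- rewrite /B -expectZ -?expectD //; try by do ?apply: bdd_measurableZ; apply: bddM.
  by apply: eq_expect => w _; rewrite innerDr innerZr mulrDl mulrA.
- apply/andP; split.
    rewrite -(expect_cst mD D1 0); apply: le_expect => //.
    + exact: bdd_measurable_cst.
    + by move=> w _; rewrite -expr2 sqr_ge0.
  rewrite -[leRHS](expect_cst mD D1); apply: le_expect => //.
  + exact: bdd_measurable_cst.
  move=> w Dw; rewrite -expr2 -real_normK ?num_real // ler_sqr ?nnegrE //.
  by rewrite (le_trans (CauchySchwarz_inner _ _)) // Dw mul1r.
Qed.

(** Pointwise, with P the partial projection, <Z, h - P h> = <Z - P Z, h> is at most |Z - P Z|,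
    whose square is 1 minus the sum of the <Z, e_i>^2 because Z is a unit vector. Integration gives
    the claim. *)
Lemma tail_second_moment (e : nat -> H) : orthoseq e -> tail_bound e B.
Proof.
move=> oE n h h1; rewrite /B.
rewrite -[X in _ <= X - _](expect_cst mD D1 1) -expect_sum //.
rewrite -expectB //; [|exact: bdd_measurable_cst
  |by apply: bdd_measurable_sum => i; exact: bddM].
apply: le_expect => //.
- apply: bdd_measurableB; first exact: bdd_measurable_cst.
  by apply: bdd_measurable_sum => i; exact: bddM.
move=> w Dw.
have -> : 1 - \sum_(i < n) inner (Z w : H) (e i) * inner (Z w : H) (e i) =
    `|(Z w : H) - partial_proj e n (Z w)| ^+ 2.
  rewrite partial_proj_residual // Dw expr1n; congr (_ - _).
  by apply: eq_bigr => i _; rewrite expr2 innerC.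
rewrite -expr2 innerBr -partial_proj_selfadj -innerBl.
rewrite -real_normK ?num_real // ler_sqr ?nnegrE //.
by rewrite (le_trans (CauchySchwarz_inner _ _)) // ler_piMr.
Qed.

(** Dominated convergence: Parseval gives the pointwise limit |Z|^2 = 1 and Bessel the dominating
    constant. *)
Lemma second_moment_trace_cvg (e : nat -> H) : basis_seq e ->
  \sum_(i < n) B (e i) (e i) @[n --> \oo] --> (1 : R).
Proof.
move=> eB; have oE : orthoseq e by case: eB.
rewrite -[X in _ --> X](expect_cst mD D1).
under eq_cvg do rewrite -expect_sum //.
apply: (@expect_cvg _ _ _ _ _ mD D1 _ _ 1).
- by move=> n; have [] := @bdd_measurable_sum _ _ _ D _ (index_enum 'I_n) _
    (fun i => bddM (e i) (e i)).
- exact: measurable_cst.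
- move=> n w Dw; under eq_bigr do rewrite -expr2 innerC.
  rewrite ger0_norm; last by apply: sumr_ge0 => i _; exact: sqr_ge0.
  by apply: le_trans (bessel _ _ oE) _; rewrite Dw expr1n.
- move=> w Dw; rewrite [X in X @ _ --> _](_ : _ =
      fun n => `|partial_proj e n (Z w)| * `|partial_proj e n (Z w)|); last first.
    apply/funext => n; rewrite -expr2 norm_partial_proj //.
    by apply: eq_bigr => i _; rewrite -expr2 innerC.
  have <- : `|Z w : H| * `|Z w : H| = 1 by rewrite Dw mulr1.
  by apply: cvgM; apply: cvg_norm; exact: basis_seq_cvg.
Qed.

Lemma second_moment_le x y : `|B x y| <= `|x| * `|y|.
Proof.
apply: le_trans (norm_expect mD D1 _) _; first exact: bddM.
rewrite -[leRHS](expect_cst mD D1); apply: le_expect => //.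
- by apply: bdd_measurable_norm; exact: bddM.
- exact: bdd_measurable_cst.
move=> w Dw; rewrite normrM ler_pM //.
- by rewrite (le_trans (CauchySchwarz_inner _ _)) // Dw mul1r.
- by rewrite (le_trans (CauchySchwarz_inner _ _)) // Dw mul1r.
Qed.

(* The Hilbert-Schmidt norm of an expectation, tested against a basis: with
   [S = sum |V e_i|^2 = E sum <V e_i, F e_i>], AM-GM gives [S <= S/2 + E K/2]. *)
Lemma expect_hs_le (V : H -> H) (F : T -> H -> H) (K : T -> R) (e : nat -> H) n :
  (forall x y, bdd_measurable D (fun w => inner x (F w y))) ->
  bdd_measurable D K ->
  (forall x y, inner x (V y) = expect mu D (fun w => inner x (F w y))) ->
  (forall w, D w -> \sum_(i < n) `|F w (e i)| ^+ 2 <= K w) ->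
  \sum_(i < n) `|V (e i)| ^+ 2 <= expect mu D K.
Proof.
move=> bF bK VF FK; set S := leLHS.
have h : 2 * S <= S + expect mu D K.
  rewrite -[X in _ <= X + _](expect_cst mD D1) -expectD //; last first.
    exact: bdd_measurable_cst.
  rewrite {1}/S; under [X in 2 * X <= _]eq_bigr do rewrite -inner_norm VF.
  rewrite -expect_sum // -expectZ //; last by apply: bdd_measurable_sum.
  apply: le_expect => //.
  - by apply: bdd_measurableZ; exact: bdd_measurable_sum.
  - by apply: bdd_measurableD => //; exact: bdd_measurable_cst.
  move=> w Dw; apply: le_trans (lerD (lexx _) (FK w Dw)).
  rewrite /S -big_split mulr_sumr; apply: ler_sum => i _ /=.
  have := sqr_ge0 `|V (e i) - F w (e i)|.
  by rewrite normB2; lra.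
by lra.
Qed.

Local Notation F := (fun w : T => tensor (Z w : H) (Z w : H)).

Let inner_F x y w : inner x (F w y) = inner (Z w : H) x * inner (Z w : H) y.
Proof. by rewrite /tensor innerZr mulrC (innerC x). Qed.

Let bdd_F x y : bdd_measurable D (fun w => inner x (F w y)).
Proof. by under eq_fun do rewrite inner_F; exact: bddM. Qed.

Let second_momentE x y : B x y = expect mu D (fun w => inner x (F w y)).
Proof. by apply: eq_expect => w _; rewrite inner_F. Qed.

Variable e : nat -> H.
Hypothesis eB : basis_seq e.

Let oE : orthoseq e. Proof. by case: eB. Qed.

(** Stated for every candidate [C], so the choice hidden in [bochner_integral] does not matter. Both
    approximation errors are Hilbert-Schmidt distances, which control the entries at [x] and [y]. *)
Lemma bochner_integral_second_moment C : is_bochner_integral mu F C ->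
  forall x y, inner x (C y) = B x y.
Proof.
move=> [_ hC [s [ss _ Fs sC]]] x y.
have lC := hs_operator_linear_continuous hC.
have lF w : linear_continuous (F w) by exact: tensor_linear_continuous.
have ls n w : linear_continuous (s n w).
  by apply: hs_operator_linear_continuous; case: (ss n).
pose c := `|x| * `|y| + 1.
have c0 : 0 < c by rewrite ltr_wpDl // mulr_ge0.
apply/eqP; rewrite -subr_eq0 -normr_le0; apply/ler_addgt0Pr => r r0.
rewrite add0r.
pose t := r / (2 * c).
have t0 : 0 < t by rewrite divr_gt0 // mulr_gt0.
have small (u : nat -> \bar R) : u @ \oo --> 0%E ->
    \forall n \near \oo, (u n <= t%:E)%E.
  move=> /fine_cvgP[fu /cvgr0Pnorm_le/(_ _ t0)] ut.
  near=> n; have un : u n \is a fin_num by near: n.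
  rewrite -(fineK un) lee_fin (le_trans (ler_norm _)) //.
  by near: n.
have [n [h1 h2]] : exists n, (\int[mu]_w hs_dist (F w) (s n w) <= t%:E)%E /\
    (hs_dist (simple_integral mu (s n)) C <= t%:E)%E.
  have : \forall n \near \oo, (\int[mu]_w hs_dist (F w) (s n w) <= t%:E)%E /\
    (hs_dist (simple_integral mu (s n)) C <= t%:E)%E.
    by near=> n; split; near: n; exact: small.
  by case=> n _ /(_ _ (leqnn n)) ?; exists n.
have e1 : `|inner x (simple_integral mu (s n) y) - inner x (C y)| <= `|x| * `|y| * t.
  rewrite -innerBr (le_trans (CauchySchwarz_inner _ _)) // -mulrA ler_wpM2l //.
  rewrite mulrC; apply: (norm_le_hs y eB _ (ltW t0) h2).
  by apply: linear_continuousB => //; exact: simple_integral_linear_continuous.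
have bs : bdd_measurable D (fun w => inner x (s n w y)).
  exact: (hs_simple_bdd_measurable D (ss n) (fun S => inner x (S y))).
have e2 : `|B x y - inner x (simple_integral mu (s n) y)| <= c * t.
  rewrite second_momentE (inner_simple_integral mD D1 DC0) // -expectB //.
  apply: le_trans (norm_expect mD D1 _) _; first exact: bdd_measurableB.
  rewrite -ler_pdivrMl // -expectZ //; last first.
    by apply: bdd_measurable_norm; exact: bdd_measurableB.
  rewrite -lee_fin -ge0_expect_setT //; first last.
  - by move=> w; rewrite mulr_ge0 // invr_ge0 ltW.
  - by apply: bdd_measurableZ; apply: bdd_measurable_norm; exact: bdd_measurableB.
  (* Measurability of the distance on the right has not been established, hence a comparison that
     asks for none; an infinite distance is harmless. *)
  apply: le_trans h1; apply: ge0_le_integral_sup => w.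
    by rewrite lee_fin mulr_ge0 // invr_ge0 ltW.
  case Kw : (hs_dist (F w) (s n w)) => [k| |].
  - have k0 : 0 <= k by rewrite -lee_fin -Kw sqrte_ge0.
    rewrite lee_fin ler_pdivrMl // -innerBr.
    rewrite (le_trans (CauchySchwarz_inner _ _)) //.
    have := norm_le_hs y eB (linear_continuousB (lF w) (ls n w)) k0.
    rewrite -Kw lexx => /(_ isT) hk.
    apply: le_trans (_ : `|x| * (k * `|y|) <= _); first by rewrite ler_wpM2l.
    by rewrite /c mulrDl mul1r mulrCA mulrC lerDl.
  - exact: leey.
  - by have : (0 <= hs_dist (F w) (s n w))%E := sqrte_ge0 _; rewrite Kw.
have -> : inner x (C y) - B x y =
  - (inner x (simple_integral mu (s n) y) - inner x (C y))
  - (B x y - inner x (simple_integral mu (s n) y)) by ring.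
apply: le_trans (ler_normB _ _) _; rewrite normrN.
have -> : r = c * t + c * t by rewrite /t; field; rewrite gt_eqF.
apply: lerD => //; apply: le_trans e1 _.
by rewrite ler_wpM2r ?(ltW t0) // lerDl.
Unshelve. all: by end_near. Qed.

(** [C] is built as the pointwise limit of the simple integrals, by completeness of [H]; that it is
    Hilbert-Schmidt and a limit in that norm is recovered afterwards from [expect_hs_le]. *)
Lemma bochner_integral_exists : separable H ->
  exists C, is_bochner_integral mu F C.
Proof.
move=> /separable_dense_seq[a da].
pose v n w := nearest a n (Z w).
pose s n w := tensor (v n w) (v n w).
pose dv n w := `|(Z w : H) - v n w|.
have bdv n : bdd_measurable D (dv n).
  split; first exact: measurable_dist_nearest.
  by exists 1 => w Dw; rewrite normr_id (le_trans (nearest_dist_le _ _ _)) // Dw.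
have v2 n w : D w -> `|v n w| <= 2.
  by move=> Dw; rewrite (le_trans (nearest_norm_le _ _ _)) // Dw mulr1.
have ss n : hs_simple (s n).
  split=> [|S|w].
  - have -> : range (s n) = (fun u => tensor u u) @` range (v n).
      by rewrite image_comp.
    apply: finite_image; apply: (sub_finite_set _ (finite_range_nearest a n)).
    by move=> _ [w _ <-]; exists (Z w).
  - exact: (measurable_nearest a mZ n [set u | tensor u u = S]).
  - exact: tensor_hs_operator eB.
have inner_s n x y w : inner x (s n w y) = inner (v n w) x * inner (v n w) y.
  by rewrite /s /tensor innerZr mulrC (innerC x).
have bs n x y : bdd_measurable D (fun w => inner x (s n w y)).
  exact: (hs_simple_bdd_measurable D (ss n) (fun S => inner x (S y))).
have dv_ge0 n w : 0 <= dv n w by exact: normr_ge0.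
have Edv_ge0 n : 0 <= expect mu D (dv n).
  rewrite -(expect_cst mD D1 0); apply: le_expect => //.
  exact: bdd_measurable_cst.
have dv0 : expect mu D (dv n) @[n --> \oo] --> (0 : R).
  rewrite -(expect_cst mD D1 0); apply: (expect_cvg mD D1 (M := 1)) => //.
  - by move=> n; case: (bdv n).
  - by move=> n w Dw; rewrite normr_id (le_trans (nearest_dist_le _ _ _)) // Dw.
  - by move=> w Dw; exact: nearest_cvg.
pose Cn n := simple_integral mu (s n).
have CnE n x y : inner x (Cn n y) = expect mu D (fun w => inner x (s n w y)).
  exact: inner_simple_integral.
(* Changing one factor at a time: 2 comes from the term containing |v| <= 2, and 1 from the term
   containing |Z| = 1. *)
have CnB n x y : `|inner x (Cn n y) - B x y| <= 3 * (`|x| * `|y|) * expect mu D (dv n).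
  rewrite CnE second_momentE -expectB //.
  apply: le_trans (norm_expect mD D1 _) _; first exact: bdd_measurableB.
  rewrite -expectZ //; apply: le_expect => //.
  - by apply: bdd_measurable_norm; exact: bdd_measurableB.
  - exact: bdd_measurableZ.
  move=> w Dw; rewrite inner_s inner_F.
  have -> : inner (v n w) x * inner (v n w) y -
        inner (Z w : H) x * inner (Z w : H) y =
      - (inner ((Z w : H) - v n w) x * inner (v n w) y
         + inner (Z w : H) x * inner ((Z w : H) - v n w) y).
    by rewrite !innerBl; ring.
  rewrite normrN; apply: le_trans (ler_normD _ _) _; rewrite !normrM.
  have i1 := CauchySchwarz_inner ((Z w : H) - v n w) x.
  have i2 := CauchySchwarz_inner ((Z w : H) - v n w) y.
  have i3 := CauchySchwarz_inner (v n w) y.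
  have i4 := CauchySchwarz_inner (Z w : H) x.
  rewrite Dw mul1r in i4.
  have i5 : `|inner (v n w) y| <= 2 * `|y|.
    by rewrite (le_trans i3) // ler_wpM2r // v2.
  have := ler_pM (normr_ge0 _) (normr_ge0 _) i1 i5.
  have := ler_pM (normr_ge0 _) (normr_ge0 _) i4 i2.
  by rewrite -/(dv n w); lra.
have Cn_cvg y : cvgn (Cn ^~ y).
  apply/cauchy_cvgP/cauchy_ballP => r r0.
  pose c := 6 * `|y| + 1.
  have c0 : 0 < c by rewrite ltr_wpDl // mulr_ge0.
  have /cvgr0Pnorm_lt/(_ (r / c)) := dv0; rewrite divr_gt0 // => /(_ isT)[N _ Nr].
  exists (Cn ^~ y @` [set n | (N <= n)%N], Cn ^~ y @` [set n | (N <= n)%N]).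
    by split; exists N => // n /= Nn; exists n.
  move=> [_ _] /= [[m /= Nm <-] [n /= Nn <-]].
  rewrite -ball_normE /=; set u := Cn m y - Cn n y.
  have dvm k : (N <= k)%N -> expect mu D (dv k) <= r / c.
    by move=> /Nr /ltW; apply: le_trans; exact: ler_norm.
  (* The entrywise bound [CnB], tested at [x := u], becomes a norm bound; it is used for [m] and for
     [n], hence 6. *)
  have : `|u| ^+ 2 <= `|u| * (6 * `|y| * (r / c)).
    rewrite -inner_norm {2}/u innerBr.
    have := CnB m u y; have := CnB n u y.
    have uy : 0 <= 3 * (`|u| * `|y|) by rewrite mulr_ge0 // mulr_ge0.
    have := ler_wpM2l uy (dvm m Nm); have := ler_wpM2l uy (dvm n Nn).
    by rewrite !ler_norml => ? ? /andP[? ?] /andP[? ?]; lra.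
  have [->|u0] := eqVneq u 0; first by rewrite normr0.
  rewrite expr2 ler_pM2l ?normr_gt0 // => /le_lt_trans; apply.
  by rewrite mulrCA -[ltRHS]mulr1 ltr_pM2l // ltr_pdivrMr // mul1r /c ltrDl.
pose C y := lim (Cn n y @[n --> \oo]).
have CB x y : inner x (C y) = B x y.
  have h1 : inner x (Cn n y) @[n --> \oo] --> inner x (C y).
    by apply: continuous_cvg; [exact: inner_continuous|exact: Cn_cvg].
  have h2 : inner x (Cn n y) @[n --> \oo] --> B x y.
    apply/cvgrPdist_le => r r0.
    pose c := 3 * (`|x| * `|y|) + 1.
    have c0 : 0 < c by rewrite ltr_wpDl // !mulr_ge0.
    have /cvgr0Pnorm_le/(_ (r / c)) := dv0; rewrite divr_gt0 // => /(_ isT).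
    apply: filterS => n dvn; rewrite distrC; apply: le_trans (CnB n x y) _.
    have -> : r = c * (r / c) by field; rewrite gt_eqF.
    apply: ler_pM; first by rewrite mulr_ge0 // mulr_ge0.
    - exact: Edv_ge0.
    - by rewrite lerDl.
    - by apply: le_trans dvn; exact: ler_norm.
  exact: (cvg_unique _ h1 h2).
have psdB := psd_second_moment.
have linC : linear C.
  move=> b x y; apply/eqP; rewrite -subr_eq0; apply/eqP/inner_eq0.
  have key u : inner u (C (b *: x + y) - (b *: C x + C y)) = 0.
    by rewrite innerBr innerDr innerZr !CB (formDr psdB) (formZr psdB) subrr.
  exact: key.
have C1 y : `|C y| <= 1 * `|y|.
  rewrite mul1r; have := second_moment_le (C y) y.
  rewrite -CB inner_norm ger0_norm ?sqr_ge0 // expr2.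
  have [->|Cy] := eqVneq (C y) 0; first by rewrite normr0.
  by rewrite ler_pM2l ?normr_gt0.
have cC : continuous C.
  apply: (@bounded_linear_continuous _ _ _ _ 1) => // x y.
  by have := linC (-1) y x; rewrite !scaleN1r ![- _ + _]addrC.
have lC : linear_continuous C by split.
have hC : hs_operator C.
  split=> //; apply: (@le_lt_trans _ _ 1%E); last exact: ltry.
  apply: (hs_norm_le eB); rewrite ?(linear_continuous0 lC) // => n.
  rewrite expr1n -(expect_cst mD D1 1).
  apply: (@expect_hs_le _ (fun w => F w)) => //.
  - exact: bdd_measurable_cst.
  - by move=> x y; rewrite CB second_momentE.
  move=> w Dw; under eq_bigr do rewrite /tensor normrZ Dw mulr1
    real_normK ?num_real // innerC.
  by apply: le_trans (bessel _ _ oE) _; rewrite Dw expr1n.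
have bK n : bdd_measurable D (fun w => 4 * (`|Z w : H| * dv n w)).
  apply: bdd_measurableZ; apply: bdd_measurableM => //; split.
    by have := measurable_dist_point mZ 0; under eq_fun do rewrite subr0.
  by exists 1 => w Dw; rewrite normr_id Dw.
have KE n : expect mu D (fun w => 4 * (`|Z w : H| * dv n w)) =
    4 * expect mu D (dv n).
  by rewrite -expectZ //; apply: eq_expect => w Dw; rewrite Dw mul1r.
have dv40 : 4 * expect mu D (dv n) @[n --> \oo] --> (0 : R).
  by rewrite -[X in _ --> X](mulr0 4); apply: cvgM => //; exact: cvg_cst.
have distFs n w : (hs_dist (F w) (s n w) <= (4 * (`|Z w : H| * dv n w))%:E)%E.
  exact: (hs_dist_tensor_le eB (nearest_norm_le _ _ _)).
exists C; split=> //; first by move=> w; exact: tensor_hs_operator eB.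
exists s; split=> //.
- apply: aeW => w.
  have h : 4 * `|Z w : H| * dv n w @[n --> \oo] --> (0 : R).
    rewrite -[X in _ --> X](mulr0 (4 * `|Z w : H|)).
    by apply: cvgM; [exact: cvg_cst|exact: nearest_cvg].
  by apply: (squeeze_cvge0 _ _ h) => n; [exact: sqrte_ge0|rewrite -mulrA].
- apply: (squeeze_cvge0 _ _ dv40) => n.
    by apply: integral_ge0 => w _; exact: sqrte_ge0.
  rewrite -KE -ge0_expect_setT //; last by move=> w; rewrite !mulr_ge0.
  by apply: ge0_le_integral_sup => w; [exact: sqrte_ge0|exact: distFs].
(* On [D] the squared distance of the tensors is at most [(4 * dv n w) ^+ 2], and [dv n w <= 1]
   lowers this to [16 * dv n w], whose mean tends to 0. *)
- have rt0 : Num.sqrt (16 * expect mu D (dv n)) @[n --> \oo] --> (0 : R).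
    rewrite -[X in _ --> X]sqrtr0; apply: continuous_cvg.
      exact: sqrt_continuous.
    by rewrite -[X in _ --> X](mulr0 16); apply: cvgM => //; exact: cvg_cst.
  apply: (squeeze_cvge0 _ _ rt0) => n; first exact: sqrte_ge0.
  have lCn : linear_continuous (Cn n) by exact: simple_integral_linear_continuous.
  apply: (hs_norm_le eB); first exact/linear_continuous0/linear_continuousB.
    exact: sqrtr_ge0.
  move=> k; rewrite sqr_sqrtr ?mulr_ge0 //.
  rewrite -expectZ //; apply: (@expect_hs_le _ (fun w => s n w - F w)).
  - move=> x y; have -> : (fun w => inner x ((s n w - F w) y)) =
        (fun w => inner x (s n w y) - inner x (F w y)).
      by apply/funext => w; rewrite -innerBr.
    exact: bdd_measurableB.
  - exact: bdd_measurableZ.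
  - move=> x y; rewrite [X in inner x X](_ : _ = Cn n y - C y) //.
    rewrite innerBr CnE CB second_momentE -expectB //.
    by apply: eq_expect => w _; rewrite -innerBr.
  move=> w Dw; apply: le_trans (_ : (4 * (`|Z w : H| * dv n w)) ^+ 2 <= _).
    under eq_bigr do rewrite -normrN.
    under eq_bigr do rewrite opprB.
    exact: (tensorB_sum_le _ oE (nearest_norm_le _ _ _)).
  rewrite Dw mul1r; have d0 : 0 <= dv n w by [].
  have : dv n w <= 1 by rewrite (le_trans (nearest_dist_le _ _ _)) // Dw.
  by nra.
Qed.

Lemma inner_bochner_integral x y : separable H ->
  inner x (bochner_integral mu F y) = second_moment x y.
Proof.
move=> /bochner_integral_exists ex.
by apply: bochner_integral_second_moment; exact: getPex.
Qed.

End SecondMoment.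

Section NullMeasure.
Import HBNNSimple.

(** Meant for conditioning on an event of probability 0. There [m] is a bare set function, known on
    measurable sets only, so the integral is computed from its definition by simple functions. *)
Lemma integral_null_measurable d (T : measurableType d) (R : realType)
    (m : set T -> \bar R) (D : set T) (f : T -> \bar R) :
  (forall A, measurable A -> m A = 0%E) -> (\int[m]_(x in D) f x = 0)%E.
Proof.
move=> m0.
have sup0 (g : T -> \bar R) : (forall x, 0 <= g x)%E ->
    ereal_sup [set sintegral m h | h in
      [set h : {nnsfun T >-> R} | forall x, ((h x)%:E <= g x)%E]] = 0%E.
  move=> g0; rewrite (_ : [set _ | _ in _] = [set 0%E]) ?ereal_sup1 //.
  have h0 (h : {nnsfun T >-> R}) : sintegral m h = 0%E.
    rewrite /sintegral fsbig1 // => r _.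
    by rewrite m0 ?mule0 //; exact: measurable_sfunP.
  apply/seteqP; split=> [_ [h _ <-]|_ ->]; first by rewrite /= h0.
  by exists nnsfun0; [move=> x; exact: g0|rewrite h0].
by rewrite /integral !sup0 ?sube0.
Qed.

End NullMeasure.

(** * Covariance operators as forms and as integrals over the sphere *)

Section Covariance.
Context {R : realType} {H : hilbertType R} d (T : measurableType d).
Variables (mu : {measure set T -> \bar R}) (Z : T -> borel H).
Hypotheses (sepH : separable H) (mZ : measurable_fun [set: T] Z).
Hypotheses (D1 : mu (on_sphere Z) = 1%E) (DC0 : mu (~` on_sphere Z) = 0%E).
Variable e : nat -> H.
Hypothesis eB : basis_seq e.

Definition covariance_form (C : H -> H) (x y : H) := inner x (C y).

Local Notation C := (bochner_integral mu (fun w => tensor (Z w : H) (Z w : H))).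

Let covariance_formE : covariance_form C = second_moment mu Z.
Proof.
by apply/funext => x; apply/funext => y; exact: (inner_bochner_integral mZ D1 DC0 eB).
Qed.

Lemma psd_covariance_form : psd_form (covariance_form C).
Proof. by rewrite covariance_formE; exact: psd_second_moment. Qed.

Lemma tail_covariance_form : tail_bound e (covariance_form C).
Proof.
by rewrite covariance_formE; apply: tail_second_moment => //; case: eB.
Qed.

Lemma covariance_form_trace_cvg :
  \sum_(i < n) covariance_form C (e i) (e i) @[n --> \oo] --> (1 : R).
Proof. by rewrite covariance_formE; exact: second_moment_trace_cvg. Qed.

(** Puts the form in the shape in which the convergence of angular laws is assumed. *)
Lemma integral_covariance_form x y :
  (\int[pushforward mu Z]_(z in unit_sphere)
     (inner (z : H) x * inner (z : H) y)%:E)%E =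
  (covariance_form C x y)%:E.
Proof.
have mi u : measurable_fun [set: borel H] (fun z : borel H => inner (z : H) u).
  by apply: continuous_borel_measurable; exact: inner_continuousl.
have mD : measurable (on_sphere Z).
  by have := mZ measurableT (@measurable_unit_sphere R H); rewrite setTI.
have bf : bdd_measurable (on_sphere Z)
    (fun w => inner (Z w : H) x * inner (Z w : H) y).
  split; first by apply: measurable_funM; exact: (measurableT_comp (mi _) mZ).
  exists (`|x| * `|y|) => w Dw; rewrite normrM ler_pM //.
  - by rewrite (le_trans (CauchySchwarz_inner _ _)) // Dw mul1r.
  - by rewrite (le_trans (CauchySchwarz_inner _ _)) // Dw mul1r.
rewrite covariance_formE /second_moment (expect_EFin mD D1 bf).
rewrite integral_pushforward //.
- by apply/measurable_EFinP; exact: measurable_funM.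
- exact: (bdd_measurable_integrable mD D1 bf).
- exact: measurable_unit_sphere.
Qed.

End Covariance.

(** * Conditioning on a large norm *)

Section Exceedance.
Context {R : realType} {H : hilbertType R} d (T : measurableType d).
Variables (P : probability T R) (X : T -> borel H).
Hypothesis mX : measurable_fun [set: T] X.

Lemma measurable_exceed t : measurable (exceed X t).
Proof.
have mn : measurable_fun [set: T] (fun w => `|X w : H|).
  by have := measurable_dist_point mX 0; under eq_fun do rewrite subr0.
have mI : measurable (`]t, +oo[%classic : set R) by exact: measurable_itv.
have := mn measurableT _ mI; rewrite setTI.
by congr measurable; apply/seteqP; split=> w /=; rewrite in_itv /= andbT.
Qed.

Lemma cond_prob_measure E : measurable E -> P E != 0%E ->
  exists mu : {measure set T -> \bar R}, (mu : set T -> \bar R) = cond_prob P E.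
Proof.
move=> mE PE0.
have PEfin : P E \is a fin_num by exact: fin_num_measure.
have r0 : 0 <= (fine (P E))^-1 by rewrite invr_ge0 fine_ge0.
exists (mscale (NngNum r0) (mrestr P mE)); apply/funext => A.
rewrite /cond_prob /mscale /mrestr /= muleC; congr (_ * _)%E.
by rewrite -[in RHS](fineK PEfin) inver fine_eq0 // (negbTE PE0).
Qed.

(** Normalisation is continuous off 0 and sends 0 to 0, so the preimage of an open set is an open
    set, together with the point 0 when the target contains 0. *)
Lemma measurable_normalize :
  measurable_fun [set: borel H] (fun x : borel H => `|x : H|^-1 *: (x : H) : borel H).
Proof.
pose f (x : H) : H := `|x|^-1 *: x.
have o0 : open [set x : H | x != 0].
  rewrite (_ : [set x | _] = ~` [set 0]); last first.
    by apply/seteqP; split=> x /= /eqP.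
  apply: closed_openC; apply: accessible_closed_set1.
  by apply: hausdorff_accessible; exact: norm_hausdorff.
apply: (@measurability _ _ (borel H) (borel H) setT _ (@open H) erefl).
move=> _ [U oU <-]; rewrite setTI.
have oA : open ([set x : H | x != 0] `&` f @^-1` U).
  rewrite openE => x [x0 Ufx]; apply: filterI.
    by apply: open_nbhs_nbhs; split.
  have : f @ x --> f x.
    apply: cvgZ; last exact: cvg_id.
    by apply: cvgV; [rewrite normr_eq0|apply: cvg_norm; exact: cvg_id].
  by apply; apply: open_nbhs_nbhs; split.
have -> : (fun x : borel H => `|x : H|^-1 *: (x : H) : borel H) @^-1` U =
    ([set x : H | x != 0] `&` f @^-1` U) `|`
    (~` [set x : H | x != 0] `&` [set _ | U 0]).
  apply/seteqP; split=> x /=.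
    have [->|x0] := eqVneq (x : H) 0; last by left.
    by rewrite scaler0; right; split=> //; rewrite eqxx.
  move=> [[]//|[/negP]]; rewrite negbK => /eqP ->.
  by rewrite scaler0.
apply: measurableU; first exact: sub_sigma_algebra.
apply: measurableI; first by apply: measurableC; exact: sub_sigma_algebra.
have [U0|U0] := pselect (U 0).
  by rewrite (_ : [set _ | _] = setT) //; apply/seteqP; split.
by rewrite (_ : [set _ | _] = set0) //; apply/seteqP; split.
Qed.

Lemma measurable_angle : measurable_fun [set: T] (angle X).
Proof. exact: (measurableT_comp measurable_normalize mX). Qed.

Lemma exceed_on_sphere t : 0 < t -> exceed X t `<=` on_sphere (angle X).
Proof.
move=> t0 w /= tX; rewrite /on_sphere /unit_sphere /= /angle normrZ.
rewrite normrV ?normr_id ?mulVf // ?unitfE normr_eq0.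
- by rewrite -normr_gt0 (lt_trans t0).
- by rewrite -normr_gt0 (lt_trans t0).
Qed.

Lemma cond_prob_on_sphere t : 0 < t -> P (exceed X t) != 0%E ->
  cond_prob P (exceed X t) (on_sphere (angle X)) = 1%E /\
  cond_prob P (exceed X t) (~` on_sphere (angle X)) = 0%E.
Proof.
move=> t0 Pt; have Es := exceed_on_sphere t0.
have Pfin : P (exceed X t) \is a fin_num.
  by apply: fin_num_measure; exact: measurable_exceed.
rewrite /cond_prob setIidr // (_ : ~` _ `&` _ = set0); last first.
  by rewrite -subset0 => w [/= nw /Es].
rewrite measure0 mul0e; split=> //.
by rewrite -(fineK Pfin) inver fine_eq0 // (negbTE Pt) -EFinM divff // fine_eq0.
Qed.

(* Testing the convergence against the constant [1]: the zero measure has no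
   mass, while [Q] is carried by the sphere. *)
Lemma exceed_neq0 (Q : probability (borel H) R) : limit_angular_measure P X Q ->
  \forall t \near +oo, P (exceed X t) != 0%E.
Proof.
move=> [Q1 QP].
have c1 : {within (unit_sphere : set H), continuous (fun=> 1 : R)}.
  by apply: continuous_subspaceT => x; exact: cvg_cst.
have b1 : exists M : R, forall x : H, unit_sphere x -> `|(1 : R)| <= M.
  by exists 1 => x _; rewrite normr1.
have := QP _ c1 b1.
have -> : (\int[Q]_(x in unit_sphere) (1 : R)%:E = 1%:E)%E.
  rewrite integral_cst; last exact: measurable_unit_sphere.
  by rewrite mul1e; exact: Q1.
move=> /fine_cvgP[_ /cvgr_dist_lt/(_ _ ltr01)].
apply: filterS => t; apply: contraTneq => Pt.
rewrite /= integral_null_measurable ?subr0 ?normr1 ?ltxx // => A mA.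
rewrite /pushforward /cond_prob (_ : P _ = 0%E) ?mul0e //.
have mE := measurable_exceed t.
apply: (subset_measure0 _ mE _ Pt); last exact: subIsetr.
apply: measurableI => //.
by have := measurable_angle measurableT mA; rewrite setTI.
Qed.

End Exceedance.

(** * Perturbation of the leading eigenspace *)

Section DavisKahan.
Context {R : realType} {H : hilbertType R}.
Implicit Types (C : H -> H) (phi : nat -> H) (lam : nat -> R).

(* Ky Fan's principle at both operators: passing from [C] to [C'] changes each
   of the two sums of [p] diagonal values by at most [p s]. *)
Lemma eigenspace_gap_le C C' lam lam' phi phi' p (s : R) :
  psd_form (covariance_form C) -> psd_form (covariance_form C') ->
  eigensystem C lam phi -> eigensystem C' lam' phi' ->
  (forall j, (j < p)%N -> `|phi j| = 1) -> (forall j, (j < p)%N -> `|phi' j| = 1) ->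
  (forall h, `|h| <= 1 -> `|covariance_form C' h h - covariance_form C h h| <= s) ->
  (lam p.-1 - lam p) *
    (p%:R - \sum_(j < p) \sum_(k < p) inner (phi' j) (phi k) ^+ 2) <= 2 * p%:R * s.
Proof.
move=> psd psd' eig eig' phi1 phi1' CC'.
have CE x y : inner x (C y) = covariance_form C x y by [].
have CE' x y : inner x (C' y) = covariance_form C' x y by [].
have oP := eigensystem_orthoseq eig; have oP' := eigensystem_orthoseq eig'.
have gap := eigen_gap psd CE eig oP' phi1' phi1.
have gap' := eigen_gap psd' CE' eig' oP phi1 phi1'.
have [_ _ _ [_ lam'd] _] := eig'.
(* No lower bound on the gap of [C'] is known; its Ky Fan inequality only yields that [phi']
   maximises the sum of diagonal values of [C']. *)
have gap'0 : 0 <= (lam' p.-1 - lam' p) *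
    (p%:R - \sum_(j < p) \sum_(k < p) inner (phi j) (phi' k) ^+ 2).
  apply: mulr_ge0; first by rewrite subr_ge0 lam'd // leq_pred.
  have -> : p%:R = \sum_(j < p) 1 :> R by rewrite sumr_const card_ord.
  rewrite subr_ge0; apply: ler_sum => j _.
  under eq_bigr do rewrite innerC.
  by apply: le_trans (bessel _ _ oP') _; rewrite phi1 // expr1n.
pose B := covariance_form C; pose B' := covariance_form C'.
have diff (f : nat -> H) : (forall j, (j < p)%N -> `|f j| = 1) ->
    `|\sum_(j < p) B' (f j) (f j) - \sum_(j < p) B (f j) (f j)| <= p%:R * s.
  move=> f1; rewrite -sumrB; apply: le_trans (ler_norm_sum _ _ _) _.
  rewrite mulr_natl -[X in _ *+ X]card_ord -sumr_const; apply: ler_sum => j _.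
  by apply: CC'; rewrite f1.
have := diff _ phi1; have := diff _ phi1'.
by rewrite /B /B' !ler_norml => /andP[? ?] /andP[? ?]; lra.
Qed.

End DavisKahan.

Lemma ge0_cvge0 (R : realType) (F : set_system R) (u : R -> \bar R) : Filter F ->
  (forall t, 0 <= u t)%E ->
  (forall s : R, 0 < s -> \forall t \near F, (u t <= s%:E)%E) ->
  u t @[t --> F] --> 0%E.
Proof.
move=> FF u0 us; apply/fine_cvgP; split.
  near=> t; rewrite ge0_fin_numE //; apply: le_lt_trans (ltry 1).
  by near: t; exact: us.
apply/cvgr0Pnorm_le => s s0.
near=> t; have uts : (u t <= s%:E)%E by near: t; exact: us.
have ut : u t \is a fin_num by rewrite ge0_fin_numE // (le_lt_trans uts) // ltry.
by rewrite /= ger0_norm ?fine_ge0 // -lee_fin fineK.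
Unshelve. all: by end_near. Qed.

(** * Convergence of the leading eigenspaces of the conditional covariances *)

Theorem corollary4p1 (R : realType) (H : hilbertType R)
    (d : measure_display) (T : measurableType d) (P : probability T R)
    (X : T -> borel H) (alpha : R) (Q : probability (borel H) R)
    (d' : measure_display) (T' : measurableType d') (P' : probability T' R)
    (Theta : T' -> borel H) (p : nat)
    (laminf : nat -> R) (phiinf : nat -> H)
    (lam : R -> nat -> R) (phi : R -> nat -> H) :
  separable H ->
  measurable_fun [set: T] X ->
  0 < alpha ->
  regularly_varying_element P X alpha ->
  limit_angular_measure P X Q ->
  measurable_fun [set: T'] Theta ->
  (forall A : set (borel H), measurable A -> pushforward P' Theta A = Q A) ->
  eigensystem (bochner_integral P' (fun w => tensor (Theta w) (Theta w)))
    laminf phiinf ->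
  (0 < p)%N ->
  laminf p < laminf p.-1 ->
  (forall t, 0 < t -> eigensystem (cov_exceed P X t) (lam t) (phi t)) ->
  rho (span_first p (phi t)) (span_first p phiinf) @[t --> +oo] --> 0%E.
Proof.
move=> sepH mX _ _ QX mTheta ThetaQ eiginf p0 gap eigt.
have [e eB] := basis_seq_exists sepH; have oE : orthoseq e by case: eB.
have mS := @measurable_unit_sphere R H.
have D1 : P' (on_sphere Theta) = 1%E.
  by have := ThetaQ _ mS; rewrite /pushforward => ->; case: QX.
have mD : measurable (on_sphere Theta).
  by have := mTheta measurableT _ mS; rewrite setTI.
have DC0 : P' (~` on_sphere Theta) = 0%E.
  by rewrite probability_setC // D1 subee.
set Cinf := bochner_integral P' _ in eiginf.
pose B t := covariance_form (cov_exceed P X t).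
have psdinf : psd_form (covariance_form Cinf).
  exact: (@psd_covariance_form _ _ _ _ P' Theta sepH mTheta D1 DC0 _ eB).
have tailinf : tail_bound e (covariance_form Cinf).
  exact: (@tail_covariance_form _ _ _ _ P' Theta sepH mTheta D1 DC0 _ eB).
have traceinf :
    \sum_(i < n) covariance_form Cinf (e i) (e i) @[n --> \oo] --> (1 : R).
  exact: (@covariance_form_trace_cvg _ _ _ _ P' Theta sepH mTheta D1 DC0 _ eB).
have intinf x y : (\int[Q]_(z in unit_sphere) (inner (z : H) x * inner (z : H) y)%:E =
    (covariance_form Cinf x y)%:E)%E.
  rewrite -(@integral_covariance_form _ _ _ _ P' Theta sepH mTheta D1 DC0 _ eB).
  by apply: eq_measure_integral => A mA _; exact: esym (ThetaQ A mA).
(* For large [t] the conditioning event has positive probability, so the conditional law is a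
   genuine measure carried by the sphere. *)
have good : \forall t \near +oo, [/\ psd_form (B t), tail_bound e (B t) &
    forall x y, (\int[pushforward (cond_prob P (exceed X t)) (angle X)]_(z in
      unit_sphere) (inner (z : H) x * inner (z : H) y)%:E = (B t x y)%:E)%E].
  near=> t.
  have t0 : 0 < t by near: t; exact: nbhs_pinfty_gt.
  have Pt : P (exceed X t) != 0%E by near: t; exact: (exceed_neq0 mX QX).
  have [mu muE] := cond_prob_measure (measurable_exceed mX t) Pt.
  have [] := cond_prob_on_sphere mX t0 Pt; rewrite -muE => mu1 mu0.
  have mA := measurable_angle mX.
  rewrite /B /cov_exceed -muE; split.
  - exact: (psd_covariance_form sepH mA mu1 mu0 eB).
  - exact: (tail_covariance_form sepH mA mu1 mu0 eB).
  - by move=> x y; exact: (integral_covariance_form sepH mA mu1 mu0 eB).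
have Bcvg x y : B t x y @[t --> +oo] --> covariance_form Cinf x y.
  have [_ /(_ (fun z => inner z x * inner z y))] := QX.
  rewrite intinf => Qxy.
  have cf : {within (unit_sphere : set H),
      continuous (fun z : H => inner z x * inner z y)}.
    by apply: continuous_subspaceT => z; apply: cvgM; exact: inner_continuousl.
  have bf : exists M : R, forall z : H, unit_sphere z ->
      `|inner z x * inner z y| <= M.
    exists (`|x| * `|y|) => z z1; rewrite normrM ler_pM //.
    + by rewrite (le_trans (CauchySchwarz_inner _ _)) // z1 mul1r.
    + by rewrite (le_trans (CauchySchwarz_inner _ _)) // z1 mul1r.
  have /fine_cvgP[_] := Qxy cf bf.
  apply: cvg_trans; apply: near_eq_cvg.
  by apply: filterS good => t [_ _ /(_ x y)] /= ->.
have lam_gap : 0 < laminf p.-1 - laminf p by rewrite subr_gt0.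
(* A padded entry has eigenvalue 0, whereas the strict gap makes the first [p] eigenvalues
   positive. *)
have phiinf1 j : (j < p)%N -> `|phiinf j| = 1.
  move=> jp; have [_ /(_ j)[//|[_ lj _]] _ [lam0 lamd] _] := eiginf.
  have : laminf p.-1 <= laminf j by apply: lamd; rewrite -ltnS prednK.
  by rewrite lj => /(lt_le_trans gap); rewrite ltNge lam0.
apply: ge0_cvge0 => [t|s s0]; first exact: sqrte_ge0.
(* Solves [2 * (1 + p) * d = s ^+ 2] with [d = 2 * p * r / gap], the bounds of [rho_le] and
   [eigenspace_gap_le]. *)
pose r := s ^+ 2 * (laminf p.-1 - laminf p) / (4 * p%:R * (1 + p%:R)).
have p0' : 0 < p%:R :> R by rewrite ltr0n.
have p1 : 0 < 1 + p%:R :> R by rewrite addr_gt0.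
have r0 : 0 < r by rewrite divr_gt0 // !mulr_gt0 // exprn_gt0.
have unif := form_cvg_uniform _ oE psdinf tailinf _
  (fun i j => Bcvg (e i) (e j)) traceinf r0.
near=> t.
have t0 : 0 < t by near: t; exact: nbhs_pinfty_gt.
have psdt : psd_form (B t) by near: t; apply: filterS good => u [].
have close h : `|h| <= 1 -> `|B t h h - covariance_form Cinf h h| <= r.
  by move: h; near: t; apply: unif; apply: filterS good => t [].
have et := eigt t t0.
(* The eigenvalues of [cov_exceed P X t] may vanish before rank [p], so padding is excluded by
   dimension, using the [p] unit vectors of the limit. *)
have phit1 : forall j, (j < p)%N -> `|phi t j| = 1.
  exact: (eigensystem_unit et (eigensystem_orthoseq eiginf) phiinf1).
have key := eigenspace_gap_le psdinf psdt eiginf et phiinf1 phit1 close.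
have := rho_le eB (eigensystem_orthoseq et) (eigensystem_orthoseq eiginf)
  phit1 phiinf1.
move=> /(_ (2 * p%:R * r / (laminf p.-1 - laminf p))).
rewrite ler_pdivlMr // mulrC => /(_ key) /le_trans; apply.
rewrite (_ : _ * _ = s ^+ 2) ?sqrtr_sqr ?ger0_norm ?(ltW s0) //.
by rewrite /r; field; rewrite !gt_eqF.
Unshelve. all: by end_near. Qed.
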